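(* Let $\mathcal L$ be a three-dimensional skip-free semi-irreducible MMRRW ($d=3$, $D=\{1,2,3\}$) with irreducible class $\mathcal S_0$, each of whose induced Markov chains $\mathcal L^A$ ($\emptyset\neq A\subset D$) is either semi-irreducible and stable, or transient. Assume $(\{0\}\times\{0\}\times\{0\}\times S^\emptyset)\cap\mathcal S_0\ne\emptyset$. Furthermore, assume $a^D<0$ (coordinatewise) and define $$r=\left|\frac{a^{\{1,2\}}(2)}{a^{\{1,2\}}(1)}\right|\left|\frac{a^{\{2,3\}}(3)}{a^{\{2,3\}}(2)}\right|\left|\frac{a^{\{3,1\}}(1)}{a^{\{3,1\}}(3)}\right|.$$ (a) If $a^{\{1,2\}}(1)<0$, $a^{\{1,2\}}(2)>0$, $a^{\{2,3\}}(2)<0$, $a^{\{2,3\}}(3)>0$, $a^{\{3,1\}}(3)<0$, $a^{\{3,1\}}(1)>0$, then $\mathcal L$ is stable if $r<1$ and unstable if $r>1$. (b) If $a^{\{1,2\}}(1)>0$, $a^{\{1,2\}}(2)<0$, $a^{\{2,3\}}(2)>0$, $a^{\{2,3\}}(3)<0$, $a^{\{3,1\}}(3)>0$, $a^{\{3,1\}}(1)<0$, then $\mathcal L$ is stable if $r>1$ and unstable if $r<1$.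
   Context: Notation (used with $d=3$): $D=\{1,\dots,d\}$; $\mathcal P(A)$ is the set of all subsets of $A$ (including $\emptyset$); for $x\in\mathbb R^d$, $x(l)$ is the $l$-th coordinate and $x(A)=(x(l))_{l\in A}$; relations between a vector and a number, such as $x(A)>0$, hold coordinatewise (vacuously if $A=\emptyset$). For $A\in\mathcal P(D)$ let $\mathcal B^A=\{x\in\mathbb R_+^d: x(A)>0,\ x(D\setminus A)=0\}$ and let $S^A=\{1,\dots,s^A\}$ be a nonempty finite set. MMRRW. A $d$-dimensional skip-free Markov modulated reflecting random walk (MMRRW) $\mathcal L=\{Y_n\}=\{(X_n,J_n)\}$ is a discrete-time homogeneous Markov chain on $\mathcal S=\bigcup_{A\in\mathcal P(D)}(\mathcal B^A\cap\mathbb Z^d)\times S^A$ such that $X_{n+1}-X_n\in\{-1,0,1\}^d$ and, whenever $x\in\mathcal B^A\cap\mathbb Z^d$, $z\in\{-1,0,1\}^d$, $x+z\in\mathcal B^B\cap\mathbb Z^d$, $i\in S^A$, $j\in S^B$, the probability $\mathbb P(Y_{n+1}=(x+z,j)\mid Y_n=(x,i))=p_z^{A,B}(i,j)$ depends only on $A,B,z,i,j$. Semi-irreducibility and stability (for any countable-state Markov chain). The chain is semi-irreducible if it has exactly one irreducible (closed communicating) class $\mathcal S_0$ and every state of $\mathcal S_0$ is accessible from every state. A semi-irreducible chain is stable if $\mathcal S_0$ is positive recurrent and from every state outside $\mathcal S_0$ the first passage time to $\mathcal S_0$ is a.s. finite with finite expectation. It is unstable if either $\mathcal S_0$ is transient,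 or there is a state outside $\mathcal S_0$ from which, with positive probability, $\mathcal S_0$ is never reached. Expanded and induced chains. Let $\emptyset\ne A\in\mathcal P(D)$. For $B\in\mathcal P(D\setminus A)$ let $\hat{\mathcal B}^{A,B}=\{x\in\mathbb R^d: x(B)>0,\ x(D\setminus(A\cup B))=0\}$ ($x(A)$ arbitrary). The expanded chain $\hat{\mathcal L}^A=\{Y^A_n\}=\{(X^A_n,J^A_n)\}$ is the Markov chain on $\hat{\mathcal S}^A=\bigcup_{B\in\mathcal P(D\setminus A)}(\hat{\mathcal B}^{A,B}\cap\mathbb Z^d)\times S^{A\cup B}$ with $\mathbb P(Y^A_{n+1}=(x+z,j)\mid Y^A_n=(x,i))=p_z^{A\cup B,A\cup C}(i,j)$ for $x\in\hat{\mathcal B}^{A,B}\cap\mathbb Z^d$, $z\in\{-1,0,1\}^d$, $x+z\in\hat{\mathcal B}^{A,C}\cap\mathbb Z^d$, $i\in S^{A\cup B}$, $j\in S^{A\cup C}$. The process $\mathcal L^A=\{(X^A_n(D\setminus A),J^A_n)\}$ is itself a Markov chain (a $(d-|A|)$-dimensional MMRRW; a finite chain if $A=D$), called the induced Markov chain with index $A$. ''$\mathcal L^A$ is transient'' means that all its states are transient (semi-irreducibility not required). If $\mathcal L^A$ is semi-irreducible and stable, the mean drift vector is $a^A=\lim_{n\to\infty}\frac1n(X^A_n-X^A_0)\in\mathbb R^d$ (a.s. limit, nonrandom); equivalently, it is the expectation of the one-step conditional mean increment vector of $X^A$ under the stationary distribution of $\mathcal L^A$. The chain $\mathcal L^D$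 is always stable, and when $a^D<0$ the chains $\mathcal L^{\{1,2\}},\mathcal L^{\{2,3\}},\mathcal L^{\{3,1\}}$ are stable, so all drift vectors in the claim exist. *)

(* Defs.v *)
From HB Require Import structures.
From mathcomp Require Import all_boot all_order all_algebra.
From mathcomp Require Import all_classical all_reals all_analysis.
Set Implicit Arguments.
Unset Strict Implicit.
Unset Printing Implicit Defensive.
Import Order.TTheory GRing.Theory Num.Theory.
Import numFieldNormedType.Exports.
Local Open Scope classical_set_scope.
Local Open Scope ring_scope.

(* A discrete-time process on S, together with one law per initial state:
   [law M x] is the distribution conditional on the process starting in x. *)
Record process (R : realType) (S : Type) := Process {
  disp : measure_display;
  space : measurableType disp;
  law : S -> probability space R;
  traj : nat -> space -> S }.
Arguments law {R S} p x.
Arguments traj {R S} p n w.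

Section ChainTheory.
Context (R : realType) (S : Type).
Implicit Types (P : S -> S -> R) (M : process R S) (C : set S) (x y : S).

(* The last clause is
   P(Y_{n+1} = u_{n+1} | Y_0 = u_0, ..., Y_n = u_n) = P u_n u_{n+1}
   in product form; S is countable wherever this is used. *)
Definition markov_chain P M : Prop :=
  [/\ forall n y, measurable (traj M n @^-1` [set y]),
      forall x, law M x (traj M 0%N @^-1` [set x]) = 1%E
    & forall x n (u : nat -> S),
        law M x [set w | forall k, (k <= n.+1)%N -> traj M k w = u k] =
        (law M x [set w | forall k, (k <= n)%N -> traj M k w = u k]
         * (P (u n) (u n.+1))%:E)%E].

Definition accessible M x y : Prop :=
  exists n, (0 < law M x (traj M n @^-1` [set y]))%E.

Definition irreducible_class M C : Prop :=
  [/\ C !=set0,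
      forall x y, C x -> C y -> accessible M x y
    & forall x y, C x -> accessible M x y -> C y].

Definition semi_irreducible M C : Prop :=
  [/\ irreducible_class M C,
      forall C', irreducible_class M C' -> C' = C
    & forall x y, C y -> accessible M x y].

(* inf {n >= 1 | Y_n \in C}, +oo if there is no such n: the return time when
   the process starts in C. *)
Definition passage_time M C (w : space M) : \bar R :=
  ereal_inf [set (n%:R)%:E | n in [set n | (0 < n)%N /\ C (traj M n w)]].

Definition finite_mean_passage M x C : Prop :=
  law M x [set w | (passage_time C w < +oo)%E] = 1%E /\
  (\int[law M x]_w passage_time C w < +oo)%E.

Definition positive_recurrent_state M x : Prop :=
  finite_mean_passage M x [set x].

Definition transient_state M x : Prop :=
  (law M x [set w | passage_time [set x] w < +oo] < 1)%E.

Definition transient_chain M : Prop := forall x, transient_state M x.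

(* In the next two, C is the irreducible class of a semi-irreducible M. *)
Definition stable M C : Prop :=
  (forall x, C x -> positive_recurrent_state M x) /\
  (forall x, ~ C x -> finite_mean_passage M x C).

Definition unstable M C : Prop :=
  (forall x, C x -> transient_state M x) \/
  (exists x, ~ C x /\ (0 < law M x [set w | forall n, ~ C (traj M n w)])%E).

Definition semi_irreducible_stable M : Prop :=
  exists C, semi_irreducible M C /\ stable M C.

End ChainTheory.

Section MMRRW.
Context (R : realType) (d : nat).
Implicit Types (A : {set 'I_d}) (x z : 'rV[int]_d).

(* The set A :|: B such that x lies in the B-part of the state space of the
   expanded chain with index A.  For A empty it is the set of positive
   coordinates of x, and everything below is about the MMRRW itself. *)
Definition face A x : {set 'I_d} := A :|: [set l | 0 < x 0 l]%SET.

Context (s : {set 'I_d} -> nat).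

Definition in_expanded A (y : 'rV[int]_d * nat) : bool :=
  [forall l, (l \notin A) ==> (0 <= y.1 0 l)] && (1 <= y.2 <= s (face A y.1))%N.

Definition expanded_state A : Type := {y : 'rV[int]_d * nat | in_expanded A y}.

Definition mmrrw_state : Type := expanded_state finset.set0.

Context (p : {set 'I_d} -> {set 'I_d} -> 'rV[int]_d -> nat -> nat -> R).

Definition expanded_kernel A (y y' : expanded_state A) : R :=
  let: (x, i) := val y in
  let: (x', j) := val y' in
  if [forall l, `|(x' - x) 0 l| <= 1]
  then p (face A x) (face A x') (x' - x) i j else 0.

Definition mmrrw_kernel : mmrrw_state -> mmrrw_state -> R :=
  @expanded_kernel finset.set0.

(* The restriction of x to the complement of A is encoded by replacing the
   coordinates in A by 0. *)
Definition forget A x : 'rV[int]_d := \row_l (if l \in A then 0 else x 0 l).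

Definition induced_state A : Type :=
  {y : 'rV[int]_d * nat | in_expanded A y && (forget A y.1 == y.1)}.

Lemma face_forget A x : face A (forget A x) = face A x.
Proof. by apply/setP => l; rewrite !inE mxE; case: (l \in A). Qed.

Lemma forget_id A x : forget A (forget A x) = forget A x.
Proof. by apply/rowP => l; rewrite !mxE; case: (l \in A). Qed.

Lemma in_induced A (y : expanded_state A) :
  in_expanded A (forget A (val y).1, (val y).2) &&
  (forget A (forget A (val y).1) == forget A (val y).1).
Proof.
case: y => -[x i] /= /andP[/forallP x_ge0 i_le].
rewrite forget_id eqxx andbT /in_expanded /= face_forget i_le andbT.
by apply/forallP => l; rewrite mxE; have := x_ge0 l; case: (l \in A).
Qed.

Definition to_induced A (y : expanded_state A) : induced_state A :=
  exist _ (forget A (val y).1, (val y).2) (in_induced y).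

Definition of_induced A (y : induced_state A) : expanded_state A :=
  exist _ (val y) (proj1 (andP (valP y))).

(* The kernel of the expanded chain is invariant under translation along A, so
   the law of the induced process does not depend on the starting point X_0(A),
   chosen to be 0. *)
Definition induced_process A (M : process R (expanded_state A)) :
    process R (induced_state A) :=
  @Process R (induced_state A) (disp M) (space M)
    (fun y => law M (of_induced y)) (fun n w => to_induced (traj M n w)).

Definition mean_drift A (M : process R (expanded_state A)) (a : 'rV[R]_d) :
    Prop :=
  forall y, {ae law M y, forall w, forall l,
    (((val (traj M n w)).1 0 l - (val (traj M 0 w)).1 0 l)%:~R / n%:R : R)
      @[n --> \oo] --> a 0 l}.

End MMRRW.

Definition k1 : 'I_3 := @Ordinal 3 0 isT.
Definition k2 : 'I_3 := @Ordinal 3 1 isT.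
Definition k3 : 'I_3 := @Ordinal 3 2 isT.

(* Main.v *)
Require Import Defs.
From HB Require Import structures.
From mathcomp Require Import all_boot all_order all_algebra.
From mathcomp Require Import all_classical all_reals all_analysis.
From mathcomp Require Import measurable_realfun zify ring lra.
Set Implicit Arguments.
Unset Strict Implicit.
Unset Printing Implicit Defensive.
Import Order.TTheory GRing.Theory Num.Theory.
Import numFieldNormedType.Exports.
Local Open Scope classical_set_scope.
Local Open Scope ring_scope.

(** A linear functional [w . x] is called sinking for the expanded chain with
    index [A] when its expected increment over [n] steps tends to [-oo] as [n]
    grows, uniformly in the starting state.  Far from the faces that are lower
    than [A] the chain looks like the expanded chain with a larger index; so if
    [w] sinks for every index [l |: A], the only states to control are, up to
    translation along [A], finitely many.  There one uses either the drift
    vector (if the induced chain is stable: [w . a^A < 0] suffices) or the fact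
    that the expected time spent there is bounded (if it is transient).

    Negative interior drift makes the three two-dimensional induced chains
    stable, with drift vectors tangent to their faces.  Under the cyclic sign
    pattern i -> j -> k -> i the functional [- x_j + K x_k] sinks around the
    axis [i], which forces the induced chain [{i}] to be transient.

    If [r < 1] there is a positive [w] with [w . a < 0] on all three faces: it
    sinks around every axis, and Foster's criterion gives stability.  If
    [r > 1] there is a positive [w] with [w . a > 0] on the three faces.  The
    interior drift of [w . x] still has the wrong sign, but the maximum over [l]
    of the forms [w . x - K x_l] increases in mean everywhere outside a finite
    set once [K] is large; an exponential supermartingale then shows that the
    chain escapes with positive probability. *)

(** * Kernels of finite range *)

(** Finitely many successors per state make every expectation a finite sum, so the drift arguments
    need no integration. *)
Record fkernel (R : realType) (S : countType) := FKernel {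
  trans :> S -> S -> R;
  nbrs : S -> seq S;
  nbrs_uniq : forall y, uniq (nbrs y);
  trans_ge0 : forall y v, 0 <= trans y v;
  trans_out : forall y v, v \notin nbrs y -> trans y v = 0;
  trans_sum : forall y, \sum_(v <- nbrs y) trans y v = 1 }.

Section Kernel.
Context (R : realType) (S : countType) (K : fkernel R S).
Implicit Types (F G f : S -> R) (y v c : S) (C : set S).

(** One-step expectation: [iter n step F y] is the mean of [F] at time [n] for the chain started in
    [y]. *)
Definition step F y : R := \sum_(v <- nbrs K y) K y v * F v.

(* The chain is killed on entering [C]; the starting state may lie in [C]. *)
Definition kill C F : S -> R := step (fun v => if v \in C then 0 else F v).

Lemma step_le F G y :
  (forall v, v \in nbrs K y -> F v <= G v) -> step F y <= step G y.
Proof.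
move=> FG; rewrite /step !big_seq; apply: ler_sum => v vy.
by rewrite ler_wpM2l ?trans_ge0 ?FG.
Qed.

Lemma eq_step F G y : (forall v, v \in nbrs K y -> F v = G v) ->
  step F y = step G y.
Proof. by move=> FG; rewrite /step; apply: eq_big_seq => v vy; rewrite FG. Qed.

Lemma stepD F G y : step (fun v => F v + G v) y = step F y + step G y.
Proof. by rewrite /step -big_split; apply: eq_bigr => v _; rewrite mulrDr. Qed.

Lemma stepZ (a : R) F y : step (fun v => a * F v) y = a * step F y.
Proof. by rewrite /step big_distrr; apply: eq_bigr => v _ /=; rewrite mulrCA. Qed.

Lemma step_cst (a : R) y : step (fun=> a) y = a.
Proof. by rewrite /step -big_distrl /= trans_sum mul1r. Qed.

Lemma iter_step_le n F G y : (forall v, F v <= G v) ->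
  iter n step F y <= iter n step G y.
Proof.
by move=> FG; elim: n y => // n IH y; rewrite !iterS; apply: step_le.
Qed.

Lemma iter_stepD n F G y :
  iter n step (fun v => F v + G v) y = iter n step F y + iter n step G y.
Proof.
elim: n y => // n IH y; rewrite !iterS -stepD; exact: eq_step.
Qed.

Lemma iter_stepZ n (a : R) F y :
  iter n step (fun v => a * F v) y = a * iter n step F y.
Proof. elim: n y => // n IH y; rewrite !iterS -stepZ; exact: eq_step. Qed.

Lemma iter_step_cst n (a : R) y : iter n step (fun=> a) y = a.
Proof.
elim: n y => // n IH y; rewrite iterS -[RHS](step_cst a y); exact: eq_step.
Qed.

Lemma eq_iter_step n F G y : F =1 G -> iter n step F y = iter n step G y.
Proof. by move=> FG; elim: n y => // n IH y; rewrite !iterS; apply: eq_step. Qed.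

Lemma iter_step_addn m n F y :
  iter (m + n) step F y = iter m step (iter n step F) y.
Proof. by rewrite iterD. Qed.

Lemma increment_ge0 f (D : R) y :
  (forall v, v \in nbrs K y -> `|f v - f y| <= D) -> 0 <= D.
Proof.
case E : (nbrs K y) => [|v s] fD.
  by have := trans_sum K y; rewrite E big_nil => /esym/eqP; rewrite oner_eq0.
by apply: le_trans (fD v _); rewrite ?mem_head.
Qed.

(** Within [n] steps [f] moves by at most [D * n], so only such states enter the two means. *)
Lemma iter_step_le_local f (D : R) n y F G :
  (forall y v, v \in nbrs K y -> `|f v - f y| <= D) ->
  (forall v, `|f v - f y| <= D * n%:R -> F v <= G v) ->
  iter n step F y <= iter n step G y.
Proof.
move=> fD; elim: n y => [|n IH] y FG; first by apply: FG; rewrite subrr normr0 mulr0.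
rewrite !iterS; apply: step_le => v vy; apply: IH => u uv; apply: FG.
rewrite -(subrKA (f v)) (le_trans (ler_normD _ _))// -natr1 mulrDr mulr1.
by rewrite lerD ?fD.
Qed.

Lemma iter_step_drift f (H : R) n y :
  (forall y, step f y <= f y + H) -> iter n step f y <= f y + H * n%:R.
Proof.
move=> fH; elim: n y => [|n IH] y; first by rewrite mulr0 addr0.
rewrite iterS (le_trans (step_le (G := fun v => f v + H * n%:R) _))//.
by rewrite stepD step_cst -natr1; have := fH y; lra.
Qed.

(** Expected sum of [F] along the times [0, ..., n - 1]. *)
Definition visits F n : S -> R :=
  iter n (fun V y => F y + step V y) (fun=> 0).

Lemma visitsS F n y : visits F n.+1 y = F y + step (visits F n) y.
Proof. by []. Qed.

Lemma visits_ge0 F n y : (forall v, 0 <= F v) -> 0 <= visits F n y.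
Proof.
move=> F0; elim: n y => // n IH y; rewrite visitsS addr_ge0//.
by rewrite -(step_cst 0 y); apply: step_le.
Qed.

Lemma visitsD F m n y :
  visits F (m + n) y = visits F m y + iter m step (visits F n) y.
Proof.
elim: m y => [|m IH] y; first by rewrite add0r.
rewrite addSn !visitsS iterS -addrA -stepD; congr (_ + _).
by apply: eq_step => v _; rewrite IH.
Qed.

Lemma visits_le F G n y : (forall v, F v <= G v) -> visits F n y <= visits G n y.
Proof.
move=> FG; elim: n y => // n IH y; rewrite !visitsS lerD//; exact: step_le.
Qed.

Lemma visits_sum (I : Type) (s : seq I) (F : I -> S -> R) n y :
  visits (fun v => \sum_(i <- s) F i v) n y = \sum_(i <- s) visits (F i) n y.
Proof.
elim: n y => [|n IH] y; first by rewrite big1.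
rewrite visitsS (eq_step (fun v _ => IH v)).
rewrite (eq_bigr _ (fun i _ => visitsS (F i) n y)) big_split /=; congr (_ + _).
rewrite /step exchange_big /=; apply: eq_bigr => v _.
by rewrite big_distrr.
Qed.

(** Off [F] the function falls at rate [e] along blocks of at most [N] steps. Each step spent in [F]
    loses at most [H + e] against that rate, and so does each of the at most [N] steps left at the
    end. *)
Lemma drift_visits f (F : pred S) (H e : R) (N : nat) m y :
  0 <= H -> 0 <= e -> (forall y, step f y <= f y + H) ->
  (forall y, ~~ F y -> exists k, [/\ (0 < k)%N, (k <= N)%N &
     iter k step f y <= f y - e * k%:R]) ->
  iter m step f y <= f y - e * m%:R + (H + e) * N%:R
                     + (H + e) * visits (fun v => (F v)%:R) m y.
Proof.
move=> H0 e0 fH fk; elim/ltn_ind: m y => m IH y.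
have V0 n v : 0 <= visits (fun v => (F v)%:R) n v.
  by apply: visits_ge0 => u; rewrite ler0n.
have [mN|Nm] := leqP m N.
  apply: (le_trans (iter_step_drift m y fH)).
  have : (H + e) * m%:R <= (H + e) * N%:R by rewrite ler_wpM2l ?addr_ge0 ?ler_nat.
  have : 0 <= (H + e) * visits (fun v => (F v)%:R) m y.
    by rewrite mulr_ge0 ?addr_ge0.
  rewrite mulrDl; lra.
have [Fy|nFy] := boolP (F y).
  case: m IH Nm => // m IH Nm; rewrite iterS visitsS Fy -[true%:R]/(1 : R).
  apply: (le_trans (step_le (fun v _ => IH m (ltnSn m) v))).
  rewrite !stepD !stepZ !step_cst -natr1; have := fH y; lra.
have [k [k0 kN fky]] := fk y nFy.
have km : (k <= m)%N by rewrite (leq_trans kN)// ltnW.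
rewrite -(subnKC km) iter_step_addn visitsD.
apply: (le_trans (iter_step_le k y (fun v => IH (m - k)%N ltac:(lia) v))).
rewrite !iter_stepD !iter_stepZ !iter_step_cst natrD.
have : 0 <= (H + e) * visits (fun v => (F v)%:R) k y by rewrite mulr_ge0 ?addr_ge0.
lra.
Qed.

(** * Killed chains: hitting times, Foster's criterion and escape *)

Lemma kill_le C F G y : (forall v, v \in nbrs K y -> F v <= G v) ->
  kill C F y <= kill C G y.
Proof. by move=> FG; apply: step_le => v vy; case: ifP => // _; exact: FG. Qed.

Lemma iter_kill_ge0 C n F y : (forall v, 0 <= F v) -> 0 <= iter n (kill C) F y.
Proof.
move=> F0; elim: n y => //= n IH y; rewrite -(step_cst 0 y).
by apply: step_le => v _; case: ifP.
Qed.

(** The iterate is the probability of avoiding [C] at the times [1, ..., n]. *)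
Lemma iter_kill1_le1 C n y : iter n (kill C) (fun=> 1) y <= 1.
Proof.
elim: n y => //= n IH y; rewrite -[leRHS](step_cst 1 y).
by apply: step_le => v _; case: ifP.
Qed.

Lemma iter_kill1_nincr C m n y : (m <= n)%N ->
  iter n (kill C) (fun=> 1) y <= iter m (kill C) (fun=> 1) y.
Proof.
move=> /subnKC <-; move: (n - m)%N => {}n.
elim: m y => [|m IH] y; first exact: iter_kill1_le1.
by rewrite addSn !iterS; apply: kill_le => v _; exact: IH.
Qed.

Lemma iter_kill_subset C C' n y : C `<=` C' ->
  iter n (kill C') (fun=> 1) y <= iter n (kill C) (fun=> 1) y.
Proof.
move=> CC'; elim: n y => //= n IH y; apply: step_le => v _.
case: ifPn => vC'; first by case: ifP => // _; exact: iter_kill_ge0.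
case: ifPn => // vC; move: vC'; rewrite notin_setE => /=.
by have /set_mem/CC' := vC.
Qed.

(** After each visit to [c] the chain never returns with probability at least [q], which bounds the
    mean number of visits as for a geometric variable. *)
Lemma visits_transient c (q : R) n y : 0 < q ->
  (forall n, q <= iter n (kill [set c]) (fun=> 1) c) ->
  visits (fun v => (v == c)%:R) n y <= 1 + q^-1.
Proof.
move=> q0 qc.
(* The induction needs the dependence on [y]: a possible visit at time 0, then [q^-1] times the
   probability of hitting [c] at the times [1, ..., n]. At [y = c] this is at most [q^-1]. *)
suff h : visits (fun v => (v == c)%:R) n y <=
    (y == c)%:R + q^-1 * (1 - iter n (kill [set c]) (fun=> 1) y).
  apply: (le_trans h); apply: lerD; first by rewrite lern1 leq_b1.
  rewrite ler_piMr ?invr_ge0 ?(ltW q0)// lerBlDr lerDl.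
  exact: iter_kill_ge0.
elim: n y => [|n IH] y; first by rewrite subrr mulr0 addr0 ler0n.
rewrite visitsS lerD2l.
apply: (@le_trans _ _ (step (fun v => q^-1 * (1 + -1 *
   (if v \in [set c] then 0 else iter n (kill [set c]) (fun=> 1) v))) y)).
  apply: step_le => v _; apply: (le_trans (IH v)).
  have -> : (v \in [set c]) = (v == c).
    by apply/idP/eqP => [/set_mem//|->]; exact/mem_set.
  case: eqP => [->|_] /=; last by rewrite add0r mulN1r.
  rewrite mulr0 addr0 mulr1 mulrBr mulr1 addrCA -[leRHS]addr0 lerD2l subr_le0.
  by rewrite mulrC ler_pdivlMr// mul1r.
by rewrite stepZ stepD step_cst stepZ mulN1r.
Qed.

(** The sum is the mean of the hitting time truncated at [n], and [F] pays one unit for each step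
    before the hit. *)
Lemma iter_kill_sum_bound C F n y : (forall v, 0 <= F v) ->
  (forall v, kill C F v <= F v - 1) ->
  \sum_(0 <= k < n) iter k (kill C) (fun=> 1) y <= F y.
Proof.
move=> F0 FC; elim: n y => [|n IH] y; first by rewrite big_geq.
rewrite big_nat_recl//= -lerBrDl; apply: le_trans (FC y).
have -> : \sum_(0 <= i < n) kill C (iter i (kill C) (fun=> 1)) y =
  kill C (fun v => \sum_(0 <= i < n) iter i (kill C) (fun=> 1) v) y.
  rewrite /kill /step exchange_big; apply: eq_bigr => v _ /=.
  rewrite -big_distrr /=; congr (_ * _); case: ifP => // _; exact: big1.
by apply: kill_le => v _; exact: IH.
Qed.

Lemma seq_ub (I : eqType) (s : seq I) (g : I -> R) :
  exists2 b : R, 0 <= b & forall i, i \in s -> g i <= b.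
Proof.
exists (\sum_(i <- s) `|g i|); first by rewrite sumr_ge0.
elim: s => // i s IH j; rewrite inE big_cons => /orP[/eqP ->|/IH h].
  by rewrite (le_trans (ler_norm _))// lerDl sumr_ge0.
by rewrite (le_trans h)// lerDr.
Qed.

Lemma seq_unif (I : eqType) (s : seq I) (Q : I -> nat -> Prop) :
  (forall i, i \in s -> exists m, forall n, (m <= n)%N -> Q i n) ->
  exists m, forall n i, (m <= n)%N -> i \in s -> Q i n.
Proof.
elim: s => [|i s IH] h; first by exists 0%N.
have [m1 h1] := h i (mem_head _ _).
have [|m2 h2] := IH; first by move=> j js; apply: h; rewrite inE js orbT.
exists (maxn m1 m2) => n j; rewrite geq_max inE => /andP[m1n m2n] /orP[/eqP ->|].
  exact: h1.
exact: h2.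
Qed.

(* [V] is a Lyapunov function off [F]; on [F] its growth is compensated by a
   multiple of [Q], the mean time before hitting [c] within [m] steps, which
   the killed kernel decreases by at least [p] there. *)
Lemma foster f n (F : seq S) c :
  (forall y, 0 <= f y) ->
  (forall y, y \notin F -> iter n step f y <= f y - 1) ->
  (forall y, y \in F -> exists m, iter m (kill [set c]) (fun=> 1) y < 1) ->
  exists W : S -> R, forall k y,
    \sum_(0 <= j < k) iter j (kill [set c]) (fun=> 1) y <= W y.
Proof.
move=> f0 fF Fc.
(* Summing over [n] successive times turns the [n]-step decrease of [f] into a one-step decrease:
   [step V - V] telescopes to [iter n step f - f]. *)
pose V y := \sum_(0 <= k < n) iter k step f y.
have iter0 k y : 0 <= iter k step f y.
  by rewrite -(iter_step_cst k 0 y); exact: iter_step_le.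
have V0 y : 0 <= V y by apply: sumr_ge0.
have stepV y : step V y = V y + iter n step f y - f y.
  have -> : step V y = \sum_(0 <= k < n) iter k.+1 step f y.
    rewrite /V /step exchange_big; apply: eq_bigr => v _ /=.
    by rewrite big_distrr.
  have := @big_nat_recl R 0 +%R n 0%N (fun k => iter k step f y) (leq0n _).
  rewrite big_nat_recr//= /V => h; lra.
have [b b0 hb] := seq_ub F (fun y => step V y - V y).
have [m hm] : exists m, forall y, y \in F -> iter m (kill [set c]) (fun=> 1) y < 1.
  have [|m hm] := @seq_unif S F (fun y m => iter m (kill [set c]) (fun=> 1) y < 1).
    move=> y /Fc [m hm]; exists m => k mk.
    by rewrite (le_lt_trans _ hm)// iter_kill1_nincr.
  by exists m => y; exact: hm.
have [p p0 hp] : exists2 p : R, 0 < p & forall y, y \in F ->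
    p <= 1 - iter m (kill [set c]) (fun=> 1) y.
  have [b' b'0 hb'] := seq_ub F (fun y => (1 - iter m (kill [set c]) (fun=> 1) y)^-1).
  have b'1 : 0 < b' + 1 by lra.
  exists (b' + 1)^-1; first by rewrite invr_gt0.
  move=> y yF; have := hm y yF; rewrite -subr_gt0 => h.
  rewrite -[leRHS]invrK lef_pV2 ?posrE ?invr_gt0//.
  by rewrite (le_trans (hb' y yF))// lerDl.
pose Q y := \sum_(0 <= k < m) iter k (kill [set c]) (fun=> 1) y.
have Q0 y : 0 <= Q y by apply: sumr_ge0 => k _; exact: iter_kill_ge0.
have killQ y : kill [set c] Q y = Q y - 1 + iter m (kill [set c]) (fun=> 1) y.
  have -> : kill [set c] Q y = \sum_(0 <= k < m) iter k.+1 (kill [set c]) (fun=> 1) y.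
    rewrite /Q /= /kill /step exchange_big; apply: eq_bigr => v _ /=.
    rewrite -big_distrr /=; congr (_ * _); case: ifP => // _; exact/esym/big1.
  have := @big_nat_recl R 0 +%R m 0%N (fun k => iter k (kill [set c]) (fun=> 1) y) (leq0n _).
  rewrite big_nat_recr//= /Q => h; lra.
(* On [F] the term [k * Q] loses at least [k * p = b + 1], which covers the growth [b] of [V] and
   leaves a decrease by 1. *)
pose k := (b + 1) / p.
have k0 : 0 <= k by rewrite divr_ge0 ?(ltW p0)// addr_ge0.
exists (fun y => V y + k * Q y) => j y.
apply: (@iter_kill_sum_bound _ (fun y => V y + k * Q y)) => v.
  by rewrite addr_ge0// mulr_ge0.
have -> : kill [set c] (fun v => V v + k * Q v) v =
    kill [set c] V v + k * kill [set c] Q v.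
  rewrite /kill -stepZ -stepD; apply: eq_step => u _; case: ifP => // _.
  by rewrite mulr0 addr0.
have killV : kill [set c] V v <= step V v.
  by apply: step_le => u _; case: ifP.
rewrite killQ.
have [vF|vF] := boolP (v \in F).
  have : b + 1 <= k * (1 - iter m (kill [set c]) (fun=> 1) v).
    by rewrite /k mulrAC ler_pdivlMr// ler_wpM2l ?addr_ge0// hp.
  have := hb v vF; lra.
have := fF v vF; have := stepV v.
have : 0 <= k * (1 - iter m (kill [set c]) (fun=> 1) v).
  by rewrite mulr_ge0// subr_ge0 iter_kill1_le1.
lra.
Qed.

Lemma step_lt_cst F (a : R) y v :
  (forall u, F u <= a) -> 0 < K y v -> F v < a -> step F y < a.
Proof.
move=> Fa yv Fva; have vy : v \in nbrs K y.
  by apply: contraLR yv => /trans_out ->; rewrite ltxx.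
rewrite -subr_gt0 -[X in X - _](step_cst a y) -mulN1r -stepZ -stepD /step.
rewrite (bigD1_seq v) ?nbrs_uniq//= ltr_pwDl//.
  by rewrite mulr_gt0// mulN1r subr_gt0.
by apply: sumr_ge0 => u _; rewrite mulr_ge0 ?trans_ge0// mulN1r subr_ge0.
Qed.

(** Being at [c] at a time [n > 0] means having hit it by then; the term [(y == c)%:R] covers
    [n = 0]. *)
Lemma iter_step_hit_le c n y : iter n step (fun v => (v == c)%:R) y <=
  (y == c)%:R + (1 - iter n (kill [set c]) (fun=> 1) y).
Proof.
elim: n y => [|n IH] y; first by rewrite subrr addr0.
apply: (@le_trans _ _ (1 - iter n.+1 (kill [set c]) (fun=> 1) y)); last first.
  by rewrite lerDr ler0n.
rewrite !iterS -[X in _ <= X - _](step_cst 1 y) -mulN1r /kill -stepZ -stepD.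
apply: step_le => v _; case: ifPn => [_|vc].
  rewrite mulr0 addr0 -[leRHS](iter_step_cst n 1 v); apply: iter_step_le => u.
  by rewrite lern1 leq_b1.
rewrite mulN1r (le_trans (IH v))//; case: eqP => [vc'|_]; last by rewrite add0r.
by move: vc; rewrite vc' mem_set.
Qed.

(** From [y != c] accessibility suffices. From [c] itself the visit at time 0 does not count, so a
    transition of positive probability is made first. *)
Lemma iter_kill_lt1 c :
  (forall y, exists n, 0 < iter n step (fun v => (v == c)%:R) y) ->
  forall y, exists m, iter m (kill [set c]) (fun=> 1) y < 1.
Proof.
move=> acc.
have off y : y != c -> exists m, iter m (kill [set c]) (fun=> 1) y < 1.
  move=> yc; have [n hn] := acc y; exists n.
  by have := iter_step_hit_le c n y; rewrite (negbTE yc) mulr0n; lra.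
move=> y; have [->|] := eqVneq y c; last exact: off.
have [v cv] : exists v, 0 < K c v.
  apply/not_existsP => h; have := trans_sum K c.
  rewrite big1 => [/esym/eqP|v _]; first by rewrite oner_eq0.
  by apply/eqP; rewrite eq_le trans_ge0 andbT leNgt; apply/negP/h.
have [vc|vc] := eqVneq v c.
  exists 1%N; apply: (step_lt_cst (v := v)) => // [u|]; first by case: ifP.
  by rewrite vc mem_set.
have [m hm] := off v vc; exists m.+1.
apply: (step_lt_cst (v := v)) => // [u|].
  by case: ifP => // _; exact: iter_kill1_le1.
by case: ifP.
Qed.

(** The bound keeps [f] above [f c] for [n] steps, so killing at [c] has no effect. *)
Lemma iter_kill_far f (D : R) c n y F :
  (forall y v, v \in nbrs K y -> `|f v - f y| <= D) ->
  f c + D * n%:R < f y -> iter n (kill [set c]) F y = iter n step F y.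
Proof.
move=> fD; elim: n y => // n IH y; rewrite -natr1 mulrDr mulr1 => fcy.
rewrite !iterS; apply: eq_step => v vy.
have fv := fD y v vy; have := ler_norm (f y - f v); rewrite distrC => fv'.
have D0 : 0 <= D by apply: le_trans fv.
have Dn : 0 <= D * n%:R by rewrite mulr_ge0.
case: ifPn => [/set_mem vc|_]; first by move: fv' fv; rewrite vc; lra.
by apply: IH; lra.
Qed.

(* [exp (- d f)] is a supermartingale along the random times [k] once [d] is
   small, because [exp (- t) <= 1 - t + 2 t^2] for [|t| <= 1/2]. *)
Lemma escape f (D c0 : R) N c y :
  (forall y v, v \in nbrs K y -> `|f v - f y| <= D) ->
  (forall y, c0 < f y -> exists k, [/\ (0 < k)%N, (k <= N)%N &
     f y + 1 <= iter k step f y]) ->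
  f c + D * N%:R <= c0 -> c0 < f y ->
  exists2 q, 0 < q & forall n, q <= iter n (kill [set c]) (fun=> 1) y.
Proof.
move=> fD fk fc fy.
have D0 : 0 <= D by exact: increment_ge0 (fD y).
(* [B] bounds the variation of [f] over [N] steps, with a margin so that [B >= 1]. The value of [d]
   gives [d * B <= 1 / 2] and makes the quadratic term [2 * d ^+ 2 * B ^+ 2] equal to [d], the gain
   due to a mean increase of [f] by 1. *)
pose B := D * N%:R + 1.
have B1 : 1 <= B by rewrite lerDr mulr_ge0.
pose d := (2 * B ^+ 2)^-1.
have d0 : 0 < d by rewrite invr_gt0 mulr_gt0// exprn_gt0// (lt_le_trans ltr01).
have dB2 : 2 * d * B ^+ 2 = 1.
  by rewrite /d mulrAC divff// mulf_neq0// ?pnatr_eq0// expf_neq0// gt_eqF// (lt_le_trans ltr01).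
have dB : d * B <= 1 / 2.
  have : d * B * 1 <= d * B * B by rewrite ler_wpM2l// mulr_ge0 ?ltW// (lt_le_trans ltr01).
  move: dB2; rewrite expr2; lra.
pose V y := expR (- (d * f y)).
have Vstep u k : (0 < k <= N)%N -> f u + 1 <= iter k step f u ->
    iter k step V u <= V u.
  move=> /andP[_ kN] fu.
  apply: (@le_trans _ _ (iter k step (fun v =>
     V u * (1 + (- d) * (f v + (- f u)) + 2 * d ^+ 2 * B ^+ 2)) u)).
    apply: (iter_step_le_local fD) => v fvu.
    have {}fvu : `|f v - f u| <= B.
      rewrite (le_trans fvu)// /B.
      by rewrite (le_trans (_ : _ <= D * N%:R))// ?lerDl// ler_wpM2l// ler_nat.
    rewrite /V; set t := d * (f v - f u).
    have -> : - (d * f v) = - (d * f u) - t by rewrite /t; ring.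
    rewrite expRD ler_wpM2l ?expR_ge0//.
    have -> : -d * (f v - f u) = - t by rewrite /t; ring.
    have tB : `|t| <= 1 / 2.
      rewrite normrM gtr0_norm//; apply: le_trans dB; rewrite ler_wpM2l// ltW//.
    have t2 : t ^+ 2 <= d ^+ 2 * B ^+ 2.
      rewrite /t exprMn ler_wpM2l ?sqr_ge0// -real_normK ?num_real//.
      by rewrite ler_sqr ?nnegrE// (le_trans _ B1).
    have : 1 + t <= expR t by exact: expR_ge1Dx.
    have : expR t * expR (- t) = 1 by rewrite expRN divff// gt_eqF ?expR_gt0.
    have : 0 < expR (- t) by exact: expR_gt0.
    move: tB; rewrite ler_norml => /andP[tl tu].
    move: (expR t) (expR (- t)) => a b b0 ab at1.
    have : (1 + t) * b <= 1 by apply: (le_trans (ler_wpM2r (ltW b0) at1)); rewrite ab.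
    (* The product is [1 + t ^+ 2 * (1 + 2 * t)], and [t >= - 1 / 2]. *)
    have : 1 <= (1 + t) * (1 - t + 2 * t ^+ 2) by nra.
    move=> h1 h2; have : (1 + t) * b <= (1 + t) * (1 - t + 2 * t ^+ 2) by lra.
    rewrite ler_pM2l; last by lra.
    lra.
  rewrite iter_stepZ !iter_stepD iter_stepZ !iter_stepD !iter_step_cst.
  rewrite ger_pMr ?expR_gt0//.
  have : d * 1 <= d * (iter k step f u - f u) by rewrite ler_wpM2l ?(ltW d0)//; lra.
  have : 2 * d ^+ 2 * B ^+ 2 = d.
    have -> : 2 * d ^+ 2 * B ^+ 2 = d * (2 * d * B ^+ 2) by ring.
    by rewrite dB2 mulr1.
  lra.
pose th := expR (- (d * c0)).
have th0 : 0 < th by exact: expR_gt0.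
have low u : f u <= c0 -> 1 <= V u / th.
  by move=> fu; rewrite ler_pdivlMr// mul1r ler_expR lerN2 ler_wpM2l// ltW.
(* Up to the level [c0] the left side is nonpositive. Above it, [V] does not increase in mean over
   the next [k] steps, and [c] is too far away to be hit meanwhile. *)
have key m u : 1 - V u / th <= iter m (kill [set c]) (fun=> 1) u.
  elim/ltn_ind: m u => m IH u.
  have [/low fu|fu] := leP (f u) c0.
    have : 0 <= iter m (kill [set c]) (fun=> 1) u by exact: iter_kill_ge0.
    lra.
  have [k [k0 kN fku]] := fk u fu.
  have far j : (j <= N)%N -> f c + D * j%:R < f u.
    move=> jN; apply: le_lt_trans fu; apply: le_trans fc.
    by rewrite lerD2l ler_wpM2l// ler_nat.
  have [mk|km] := leqP m k.
    rewrite (iter_kill_far _ fD) ?iter_step_cst ?far ?(leq_trans mk)//.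
    by rewrite gerBl divr_ge0// expR_ge0.
  rewrite -(subnKC (ltnW km)) iterD (iter_kill_far _ fD) ?far//.
  apply: (@le_trans _ _ (iter k step (fun v => 1 + (- th^-1) * V v) u)).
    rewrite iter_stepD iter_step_cst iter_stepZ mulNr lerD2l lerN2 mulrC.
    by rewrite ler_wpM2r ?invr_ge0 ?(ltW th0)//; apply: Vstep => //; rewrite k0.
  apply: iter_step_le => v; rewrite mulNr [_ * V v]mulrC; apply: IH; lia.
exists (1 - V y / th) => [|n]; last exact: key.
by rewrite subr_gt0 ltr_pdivrMr// mul1r ltr_expR ltrN2 ltr_pM2l.
Qed.

End Kernel.

(** * Laws of trajectories *)

Section Trajectories.
Context (R : realType) (S : countType) (P : S -> S -> R) (M : process R S).
Hypothesis MP : markov_chain P M.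
Implicit Types (x y v : S) (B C : set S).

Lemma measurable_traj n B : measurable (traj M n @^-1` B).
Proof.
have [mM _ _] := MP.
rewrite (_ : _ @^-1` _ = \bigcup_k
    (if @unpickle S k is Some v then
       if v \in B then traj M n @^-1` [set v] else set0 else set0)).
  apply: bigcup_measurable => k _; case: unpickle => // v.
  by case: ifP.
apply/seteqP; split => [w /= Bw|w [k _]] /=.
  by exists (pickle (traj M n w)) => //; rewrite pickleK mem_set.
by case: unpickle => // v; case: ifPn => // /set_mem Bv /= ->.
Qed.

Lemma measurable_path (B : nat -> set S) n m :
  measurable [set w | forall k, (k <= m)%N -> B k (traj M (n + k) w)].
Proof.
rewrite (_ : mkset _ = \bigcap_k (if (k <= m)%N then traj M (n + k) @^-1` B k else setT)).
  by apply: bigcap_measurable => // k _; case: ifP => // _; exact: measurable_traj.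
apply/seteqP; split => w /= h k; first by case: ifP => // km _; exact: h.
by move=> km; have := h k I; rewrite km.
Qed.

Lemma law_start x : law M x [set w | traj M 0%N w = x] = 1%E.
Proof. by have [_ + _] := MP; exact. Qed.

Definition path_event (u : nat -> S) n :=
  [set w : Defs.space M | forall k, (k <= n)%N -> traj M k w = u k].

Lemma measurable_path_event u n : measurable (path_event u n).
Proof. exact: (measurable_path (fun k => [set u k]) 0 n). Qed.

Lemma law_path1 x y : law M x (path_event (fun k => if k is 0 then x else y) 1) =
  (P x y)%:E.
Proof.
have [_ _ h] := MP; have := h x 0%N (fun k => if k is 0 then x else y).
rewrite -/(path_event _ _) => ->.
rewrite (_ : mkset _ = [set w | traj M 0%N w = x]) ?law_start ?mul1e//.
by apply/seteqP; split => w /= hw; [exact: hw | case].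
Qed.

(** Only the existence of a process with kernel [P] is supposed; nonnegativity of [P], and further
    down its row sums, are read off the joint law of the first two states. *)
Lemma markov_ge0 x y : 0 <= P x y.
Proof. by rewrite -lee_fin -law_path1. Qed.

(** [S] is countable, so the states outside [s], null one by one, are null together. *)
Lemma law_split x n (s : seq S) (E : set (Defs.space M)) :
  measurable E -> uniq s ->
  (forall v, v \notin s -> law M x (E `&` traj M n @^-1` [set v]) = 0%E) ->
  law M x E = (\sum_(v <- s) law M x (E `&` traj M n @^-1` [set v]))%E.
Proof.
move=> mE us s0.
have split1 : law M x E = (\sum_(v <- s) law M x (E `&` traj M n @^-1` [set v]) +
    law M x (E `&` traj M n @^-1` [set v | v \notin s]))%E.
  elim: s us {s0} => [_|v s IH /= /andP[vs us]].
    by rewrite big_nil add0e (_ : _ @^-1` _ = setT) ?setIT//; apply/seteqP; split.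
  rewrite IH// big_cons addeAC [LHS]addeC; congr (_ + _)%E.
  rewrite -measureU; last 3 first.
  - by apply: measurableI => //; exact: measurable_traj.
  - by apply: measurableI => //; exact: measurable_traj.
  - apply/seteqP; split => w //= -[[_ wv] [_]].
    by rewrite inE negb_or wv eqxx.
  congr (law M x _); rewrite -setIUr; congr (_ `&` _).
  apply/seteqP; split => w /=.
    by move=> ws; rewrite inE negb_or ws andbT; case: eqVneq; [left|right].
  by rewrite inE negb_or; case=> [->//|/andP[]].
rewrite split1 [X in (_ + X)%E](_ : _ = 0%E) ?adde0//.
apply/negligibleP.
  by apply: measurableI => //; exact: measurable_traj.
pose G k := if @unpickle S k is Some v then
       if v \notin s then E `&` traj M n @^-1` [set v] else set0 else set0.
apply: (negligibleS (A := \bigcup_k G k)).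
  move=> w /= [Ew ws]; exists (pickle (traj M n w)) => //.
  by rewrite /G pickleK ws.
apply: negligible_bigcup => k; rewrite /G.
case: unpickle => [v|]; last exact: negligible_set0.
case: ifPn => [vs|_]; last exact: negligible_set0.
apply/negligibleP; last exact: s0.
by apply: measurableI => //; exact: measurable_traj.
Qed.

Lemma law_startI x (E : set (Defs.space M)) : measurable E ->
  law M x (E `&` [set w | traj M 0%N w = x]) = law M x E.
Proof.
move=> mE; have [mM _ _] := MP.
rewrite [RHS](@law_split x 0%N [:: x])//.
  by rewrite big_seq1.
move=> v; rewrite inE => vx; apply/eqP; rewrite eq_le measure_ge0 andbT.
have st : law M x (traj M 0%N @^-1` [set x]) = 1%E by exact: (law_start x).
have : law M x (traj M 0%N @^-1` [set v] `|` traj M 0%N @^-1` [set x]) = 1%E.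
  apply/eqP; rewrite eq_le probability_le1/=; last first.
    by apply: measurableU; exact: mM.
  rewrite -st; apply: le_measure; rewrite ?inE//.
  by apply: measurableU; exact: mM.
move=> h; have : (law M x (traj M 0%N @^-1` [set v]) +
    law M x (traj M 0%N @^-1` [set x]) = 1)%E.
  rewrite -h measureU//.
  by apply/seteqP; split => w //= -[-> xv]; rewrite xv eqxx in vx.
rewrite st {h}.
have fin : law M x (traj M 0%N @^-1` [set v]) \is a fin_num.
  by apply: fin_num_measure; exact: mM.
move=> /eqP; rewrite -(fineK fin) -EFinD eqe -subr_eq0 addrK => /eqP h.
apply: (@le_trans _ _ (law M x (traj M 0%N @^-1` [set v]))).
  apply: le_measure; rewrite ?inE//; apply: measurableI => //; exact: mM.
by rewrite -(fineK fin) h.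
Qed.

Lemma markov_sum1 x (s : seq S) : uniq s -> (forall v, v \notin s -> P x v = 0) ->
  \sum_(v <- s) P x v = 1.
Proof.
move=> us s0.
have [mM _ _] := MP.
have := @law_split x 1%N s [set w | traj M 0%N w = x] (mM 0%N x) us.
have E v : [set w | traj M 0%N w = x] `&` traj M 1%N @^-1` [set v] =
    path_event (fun k => if k is 0 then x else v) 1.
  apply/seteqP; split => w /=; first by move=> [h0 h1] [|[|k]].
  by move=> h; split; [exact: (h 0%N)|exact: (h 1%N)].
rewrite law_start; under eq_bigr do rewrite E law_path1.
move=> h; apply/EFin_inj; rewrite -sumEFin -h// => v vs.
by rewrite E law_path1 s0.
Qed.

End Trajectories.
Arguments path_event {R S} M u n.

(** * Path probabilities computed from the kernel *)

Section Law.
Context (R : realType) (S : countType) (K : fkernel R S) (M : process R S).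
Hypothesis MK : markov_chain K M.
Implicit Types (x y v c : S) (C : set S).

(** Probability, starting from [y], of lying in [B k] at every time [k <= n]. *)
Fixpoint cyl n (B : nat -> set S) y : R :=
  (y \in B 0%N)%:R * (if n is n'.+1 then step K (cyl n' (fun k => B k.+1)) y else 1).

(** Markov property after the initial path [u]; the induction on [m] splits the future according to
    the next state. *)
Lemma law_path_cyl x m n u (B : nat -> set S) :
  law M x (path_event M u n `&`
    [set w | forall k, (k <= m)%N -> B k (traj M (n + k) w)]) =
  (law M x (path_event M u n) * (cyl m B (u n))%:E)%E.
Proof.
have [_ _ MK3] := MK.
elim: m n u B => [|m IH] n u B.
  rewrite /= mulr1; case: (boolP (u n \in B 0%N)) => [/set_mem Bu|].
    rewrite mule1; congr (law M x _); apply/seteqP; split => w; first by case.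
    move=> uw; split => // k; rewrite leqn0 => /eqP ->.
    by rewrite addn0 uw.
  rewrite notin_setE => nB; rewrite mule0 -[RHS](measure0 (law M x)).
  congr (law M x _); apply/seteqP; split => w // -[uw /(_ 0%N isT)].
  by rewrite addn0 uw.
have [/set_mem Bu|nB] := boolP (u n \in B 0%N); last first.
  rewrite /= (negbTE nB) mul0r mule0 -[RHS](measure0 (law M x)).
  move: nB; rewrite notin_setE => nB.
  congr (law M x _); apply/seteqP; split => w // -[uw /(_ 0%N isT)].
  by rewrite addn0 uw.
rewrite /= mem_set//= mul1r.
(* [u' v] prolongs the path [u] by the state [v] at time [n.+1]. *)
pose u' v k := if (k <= n)%N then u k else v.
have E v : (path_event M u n `&`
    [set w | forall k, (k <= m.+1)%N -> B k (traj M (n + k) w)]) `&`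
    traj M n.+1 @^-1` [set v] = path_event M (u' v) n.+1 `&`
    [set w | forall k, (k <= m)%N -> B k.+1 (traj M (n.+1 + k) w)].
  apply/seteqP; split => w /=.
    move=> [[uw Bw] vw]; split => k.
      rewrite leq_eqVlt ltnS /u' => /orP[/eqP ->|kn]; first by rewrite ltnn.
      by rewrite kn uw.
    by move=> km; rewrite addSnnS; exact: Bw.
  move=> [uw Bw]; split; last by have /= := uw _ (leqnn _); rewrite /u' ltnn.
  have uw' k : (k <= n)%N -> traj M k w = u k.
    by move=> kn; rewrite uw ?(leq_trans kn)// /u' kn.
  split => // -[_|k km]; first by rewrite addn0 uw'.
  by rewrite addnS -addSn; exact: Bw.
have L v : law M x (path_event M (u' v) n.+1) =
    (law M x (path_event M u n) * (K (u n) v)%:E)%E.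
  have := MK3 x n (u' v); rewrite -!/(path_event M _ _) {3 4}/u' leqnn ltnn => ->.
  congr (law M x _ * _)%E; apply/seteqP.
  by split => w /= h k kn; rewrite h// /u' kn.
have IHv v := IH n.+1 (u' v) (fun k => B k.+1).
rewrite (@law_split _ _ _ _ MK x n.+1 (nbrs K (u n))); last 3 first.
- apply: measurableI; first exact: (measurable_path_event MK).
  exact: (measurable_path MK).
- exact: nbrs_uniq.
- move=> v vu; rewrite E IHv L (trans_out vu) mule0 mul0e//.
under eq_bigr do rewrite E IHv L.
have fin : law M x (path_event M u n) \is a fin_num.
  by apply: fin_num_measure; exact: (measurable_path_event MK).
rewrite -(fineK fin) -EFinM /step big_distrr /= -sumEFin.
apply: eq_bigr => v _; rewrite /u' ltnn.
by rewrite -!EFinM mulrA.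
Qed.

Lemma law_cyl x n (B : nat -> set S) :
  law M x [set w | forall k, (k <= n)%N -> B k (traj M k w)] = (cyl n B x)%:E.
Proof.
have := law_path_cyl x n 0 (fun=> x) B.
have mB : measurable [set w | forall k, (k <= n)%N -> B k (traj M k w)].
  exact: (measurable_path MK B 0 n).
have -> : path_event M (fun=> x) 0 = [set w | traj M 0%N w = x].
  by apply/seteqP; split => w /=; [exact|move=> h [|]].
rewrite (law_start MK) mul1e => <-.
by rewrite setIC (law_startI MK).
Qed.

Lemma law_at x n (B : set S) :
  law M x (traj M n @^-1` B) = (iter n (step K) (fun v => (v \in B)%:R) x)%:E.
Proof.
transitivity (law M x [set w | forall k, (k <= n)%N ->
    (if k == n then B else setT) (traj M k w)]).
  congr (law M x _); apply/seteqP; split => w /=.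
    by move=> Bw k _; case: eqP => // ->.
  by move=> /(_ n (leqnn n)); rewrite eqxx.
rewrite (law_cyl x n (fun k => if k == n then B else setT)); congr EFin.
elim: n x => [|n IH] x; first by rewrite /= mulr1.
rewrite /= in_setT mul1r; apply: eq_step => v _.
by rewrite -IH; congr (cyl n _ v); apply/funext => k; rewrite eqSS.
Qed.

(** Time 0 does not count, in agreement with [passage_time]. *)
Definition avoid C n :=
  [set w : Defs.space M | forall k, (0 < k <= n)%N -> ~ C (traj M k w)].

Lemma law_avoid x n C :
  law M x (avoid C n) = (iter n (kill K C) (fun=> 1) x)%:E.
Proof.
transitivity (law M x [set w | forall k, (k <= n)%N ->
    (if k is 0 then setT else ~` C) (traj M k w)]).
  congr (law M x _); apply/seteqP; split => w /= h k.
    by case: k => // k kn; exact: h.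
  by case: k => // k kn; exact: (h k.+1).
rewrite (law_cyl x n (fun k => if k is 0 then setT else ~` C)); congr EFin.
case: n => [|n] /=; first by rewrite in_setT mulr1.
rewrite in_setT mul1r; apply: eq_step => v _.
elim: n v => [|n IH] v /=; rewrite in_setC; first by case: (v \in C); rewrite mulr1.
case: (v \in C) => /=; first by rewrite mul0r.
by rewrite mul1r; apply: eq_step => u _; exact: IH.
Qed.

Lemma measurable_avoid C n : measurable (avoid C n).
Proof.
rewrite (_ : avoid C n = [set w | forall k, (k <= n)%N ->
    (if k is 0 then setT else ~` C) (traj M (0 + k) w)]).
  exact: (measurable_path MK (fun k => if k is 0 then setT else ~` C) 0 n).
apply/seteqP; split => w /= h k.
  by case: k => // k kn; exact: h.
by case: k => // k kn; exact: (h k.+1).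
Qed.

Lemma accessibleP x y :
  accessible M x y <-> exists n, 0 < iter n (step K) (fun v => (v == y)%:R) x.
Proof.
have E n : law M x (traj M n @^-1` [set y]) =
    (iter n (step K) (fun v => (v == y)%:R) x)%:E.
  rewrite law_at; congr EFin; apply: eq_iter_step => v.
  by congr ((nat_of_bool _)%:R); apply/idP/eqP => [/set_mem//|->]; exact/mem_set.
by split=> -[n]; rewrite ?E ?lte_fin => h; exists n; rewrite ?E ?lte_fin.
Qed.

End Law.
Arguments avoid {R S} M C n.

(** * Passage times *)

Section Passage.
Context (R : realType) (S : countType) (K : fkernel R S) (M : process R S).
Hypothesis MK : markov_chain K M.
Implicit Types (x y v c : S) (C : set S).

Definition never C := [set w : Defs.space M | forall k, (0 < k)%N -> ~ C (traj M k w)].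

Lemma never_bigcap C : never C = \bigcap_n avoid M C n.
Proof.
apply/seteqP; split => w h; first by move=> n _ k /andP[k0 _]; exact: h.
by move=> k k0; apply: (h k I k); rewrite k0/=.
Qed.

Lemma measurable_never C : measurable (never C).
Proof.
rewrite never_bigcap; apply: bigcap_measurable => // n _.
exact: (measurable_avoid MK).
Qed.

(* Escape probability; the visit at time 0 does not count. *)
Definition esc C x : R := fine (law M x (never C)).

Lemma esc_ge0 C x : 0 <= esc C x.
Proof. exact: fine_ge0. Qed.

Lemma law_never C x : law M x (never C) = (esc C x)%:E.
Proof. by rewrite fineK// fin_num_measure//; exact: measurable_never. Qed.

Lemma esc_cvg C x : iter n (kill K C) (fun=> 1) x @[n --> \oo] --> esc C x.
Proof.
have : law M x \o avoid M C @ \oo --> law M x (\bigcap_n avoid M C n).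
  apply: nonincreasing_cvg_mu.
  - by rewrite (le_lt_trans (probability_le1 _ _)) ?ltry//; exact: (measurable_avoid MK).
  - by move=> n; exact: (measurable_avoid MK).
  - by rewrite -never_bigcap; exact: measurable_never.
  - move=> m n mn; apply/subsetPset => w h k /andP[k0 km]; apply: h.
    by rewrite k0 (leq_trans km).
rewrite -never_bigcap law_never => /fine_cvg.
by apply: cvg_trans; apply: near_eq_cvg; apply: nearW => n /=; rewrite (law_avoid MK).
Qed.

Lemma esc_le C x n : esc C x <= iter n (kill K C) (fun=> 1) x.
Proof.
rewrite -lee_fin -(law_avoid MK) -law_never; apply: le_measure; rewrite ?inE.
- exact: measurable_never.
- exact: (measurable_avoid MK).
- by move=> w h k /andP[k0 _]; exact: h.
Qed.

Lemma le_esc C x (q : R) : (forall n, q <= iter n (kill K C) (fun=> 1) x) ->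
  q <= esc C x.
Proof.
move=> h; rewrite -(cvg_lim (@Rhausdorff R) (@esc_cvg C x)).
apply: limr_ge; last exact: nearW.
by apply/cvg_ex; exists (esc C x); exact: esc_cvg.
Qed.

Lemma esc_kill C x : esc C x = kill K C (esc C) x.
Proof.
apply: (cvg_unique (@Rhausdorff R) (F := (iter n.+1 (kill K C) (fun=> 1) x @[n --> \oo]))).
  have := @esc_cvg C x.
  by rewrite -(cvg_shiftS (fun n => iter n (kill K C) (fun=> 1) x)).
rewrite /= /kill /step.
apply: cvg_big => [|v _]; first exact: add_continuous.
by apply: cvgMl_tmp; case: ifP => _; [exact: cvg_cst|exact: esc_cvg].
Qed.

Lemma passage_time_lt C w : (passage_time C w < +oo)%E <-> ~ never C w.
Proof.
split=> [/ereal_inf_lt[_ [n /= [n0 Cn] _] _] h|].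
  exact: (h n n0).
move=> /existsNP[n /not_implyP[n0 /contrapT Cn]].
apply: (@le_lt_trans _ _ (n%:R)%:E); last exact: ltry.
by apply: ereal_inf_lbound; exists n.
Qed.

Lemma law_passage C x :
  law M x [set w | (passage_time C w < +oo)%E] = (1 - esc C x)%:E.
Proof.
have -> : [set w | (passage_time C w < +oo)%E] = ~` never C.
  by apply/seteqP; split => w /passage_time_lt.
by rewrite probability_setC ?law_never//; exact: measurable_never.
Qed.

Lemma transient_stateP x : transient_state M x <-> 0 < esc [set x] x.
Proof.
by rewrite /transient_state law_passage -[1%E]/((1:R)%:E) lte_fin gtrBl.
Qed.

(** Tail formula: the passage time is the number of [n] that it exceeds, also when it is
    infinite. *)
Lemma passage_time_series C w :
  passage_time C w = (\sum_(0 <= n <oo) (\1_(avoid M C n) w)%:E)%E.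
Proof.
have ind0 n : (0 <= (\1_(avoid M C n) w : R)%:E)%E by rewrite lee_fin.
apply/eqP; rewrite eq_le; apply/andP; split; last first.
  apply: lime_le; first by apply: is_cvg_nneseries.
  apply: nearW => N; apply: le_ereal_inf_tmp => _ [k /= [k0 Ck] <-].
  rewrite sumEFin lee_fin.
  apply: (@le_trans _ _ (\sum_(0 <= i < N) (if (i < k)%N then 1 else 0))).
    apply: ler_sum => i _; rewrite indicE; case: (ltnP i k) => ik.
      by rewrite lern1 leq_b1.
    rewrite memNset// => /(_ k); rewrite k0 ik => /(_ isT); exact.
  rewrite -big_mkcond /= big_const_seq iter_addr addr0 -mulr_natl mulr1.
  rewrite ler_nat; have := @uniq_leq_size _ [seq i <- iota 0 (N - 0) | (i < k)%N]
    (iota 0 k) (filter_uniq _ (iota_uniq _ _)).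
  rewrite size_iota size_filter; apply => i.
  by rewrite mem_filter !mem_iota /= => /andP[].
have [hit|nhit] := pselect (exists k, (0 < k)%N && `[< C (traj M k w) >]).
  case: (ex_minnP hit) => k /andP[k0 /asboolP Ck] kmin.
  apply: (@le_trans _ _ (k%:R)%:E); first by apply: ereal_inf_lbound; exists k.
  apply: le_trans (nneseries_lim_ge k (fun n _ _ => ind0 n)).
  rewrite sumEFin lee_fin.
  rewrite -[X in X%:R <= _]subn0 -sumr_const_nat.
  apply: ler_sum_nat => i /= ik; rewrite indicE mem_set// => j /andP[j0 ji] Cj.
  have := kmin j; rewrite j0 asboolT//= => /(_ isT) kj.
  by have := leq_ltn_trans kj (leq_ltn_trans ji ik); rewrite ltnn.
suff -> : (\sum_(0 <= n <oo) (\1_(avoid M C n) w : R)%:E)%E = +oo%E by rewrite leey.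
apply/eqyP => r r0; have [N rN] : exists N, r <= N%:R.
  by exists (Num.Def.archi_bound r); apply/ltW/archi_boundP/ltW.
apply: le_trans (nneseries_lim_ge N (fun n _ _ => ind0 n)).
rewrite sumEFin lee_fin (le_trans rN)//.
rewrite -[X in X%:R <= _]subn0 -sumr_const_nat.
apply: ler_sum_nat => i /= _; rewrite indicE mem_set// => j /andP[j0 _] Cj.
by apply: nhit; exists j; rewrite j0 asboolT.
Qed.

(** Integrating the tail formula term by term bounds the mean by [W]. Passage is almost sure because
    [n%:R * esc C x] also stays below [W] for every [n]. *)
Lemma finite_mean_passage_bounded C x (W : R) :
  (forall n, \sum_(0 <= k < n) iter k (kill K C) (fun=> 1) x <= W) ->
  finite_mean_passage M x C.
Proof.
move=> hW.
have sumE : (\int[law M x]_w passage_time C w =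
    \sum_(0 <= n <oo) (iter n (kill K C) (fun=> 1) x)%:E)%E.
  under eq_integral do rewrite passage_time_series.
  rewrite integral_nneseries//; last first.
    move=> n; apply/measurable_EFinP; apply: measurable_indic.
    exact: (measurable_avoid MK).
  apply: eq_eseriesr => n _; rewrite integral_indic ?setIT//.
    exact: (law_avoid MK).
  exact: (measurable_avoid MK).
split; last first.
  rewrite sumE; apply: (@le_lt_trans _ _ W%:E); last exact: ltry.
  apply: lime_le; first by apply: is_cvg_nneseries => n _ _; rewrite lee_fin iter_kill_ge0.
  by apply: nearW => N; rewrite sumEFin lee_fin.
rewrite law_passage; suff -> : esc C x = 0 by rewrite subr0.
apply/eqP; rewrite eq_le esc_ge0 andbT leNgt; apply/negP => e0.
have := archi_boundP (normr_ge0 (W / esc C x)).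
set N := Num.Def.archi_bound _ => /(le_lt_trans (ler_norm _)).
rewrite ltr_pdivrMr// => WN.
suff /(lt_le_trans WN) : N%:R * esc C x <= W by rewrite ltxx.
apply: le_trans (hW N); rewrite -[N in leLHS]subn0 mulr_natl -sumr_const_nat.
by apply: ler_sum => i _; exact: esc_le.
Qed.

Lemma iter_step_accessible (F : S -> R) x y :
  (forall v, 0 <= F v) -> 0 < F y -> accessible M x y ->
  exists n, 0 < iter n (step K) F x.
Proof.
move=> F0 Fy /(accessibleP MK)[n hn]; exists n.
apply: (@lt_le_trans _ _ (F y * iter n (step K) (fun v => (v == y)%:R) x)).
  by rewrite mulr_gt0.
rewrite -iter_stepZ; apply: iter_step_le => v.
by case: eqP => [->|_]; rewrite ?mulr1 ?mulr0.
Qed.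

(* [esc [set c]] is harmonic for the chain killed at [c].  If it vanished at
   [c] it would be harmonic, hence zero on [C], hence at most the probability
   of never reaching [C], which is zero. *)
Lemma unstable_escape C : irreducible_class M C ->
  (forall c, C c -> exists y, 0 < esc [set c] y) -> unstable M C.
Proof.
move=> [_ Cacc _] escC.
have [h|h] := pselect (exists x, ~ C x /\
  (0 < law M x [set w | forall n, ~ C (traj M n w)])%E); [by right|left].
have esc0 x : ~ C x -> esc C x = 0.
  move=> nCx; apply/eqP; rewrite eq_le esc_ge0 andbT leNgt; apply/negP => e0.
  apply: h; exists x; split => //.
  rewrite (lt_le_trans (_ : 0 < (esc C x)%:E)%E)// -law_never.
  rewrite -(law_startI MK); last exact: measurable_never.
  have [mM _ _] := MK.
  apply: le_measure; rewrite ?inE.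
  - apply: measurableI; [exact: measurable_never|exact: mM].
  - rewrite (_ : mkset _ = \bigcap_n (traj M n @^-1` (~` C))).
      by apply: bigcap_measurable => // n _; exact: (measurable_traj MK).
    by apply/seteqP; split => w /= hw n; [move=> _; exact: hw|exact: (hw n I)].
  - by move=> w /= [hw w0] [|n]; [rewrite w0|exact: hw].
move=> c Cc; apply/transient_stateP; rewrite lt0r esc_ge0 andbT.
apply/eqP => ec0; have [y0] := escC c Cc.
suff escc0 y : esc [set c] y = 0 by rewrite escc0 ltxx.
have escE y' : esc [set c] y' = step K (esc [set c]) y'.
  rewrite [LHS]esc_kill; apply: eq_step => v _; case: ifP => // /set_mem ->.
  by rewrite ec0.
have iterE n y' : iter n (step K) (esc [set c]) y' = esc [set c] y'.
  elim: n y' => // n IH y'; rewrite iterS [RHS]escE; exact: eq_step.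
have eC v : C v -> esc [set c] v = 0.
  move=> Cv; apply/eqP; rewrite eq_le esc_ge0 andbT leNgt; apply/negP => ev0.
  have [n] := iter_step_accessible (@esc_ge0 [set c]) ev0 (Cacc c v Cc Cv).
  by rewrite iterE ec0 ltxx.
have eK n y' : esc [set c] y' <= iter n (kill K C) (fun=> 1) y'.
  elim: n y' => [|n IH] y'; first exact: (esc_le [set c] y' 0).
  rewrite escE iterS; apply: step_le => v _.
  by case: ifPn => [/set_mem/eC ->//|_]; exact: IH.
have [Cy|nCy] := pselect (C y); first exact: eC.
apply/eqP; rewrite eq_le esc_ge0 andbT -(esc0 _ nCy); apply: le_esc.
by move=> n; exact: eK.
Qed.

Lemma stable_unstableF C : C !=set0 -> stable M C -> unstable M C -> False.
Proof.
move=> [c Cc] [pos fin] [tr|[x [nCx h]]].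
  have := tr c Cc; have [hc _] := pos c Cc; rewrite /transient_state.
  by rewrite hc ltxx.
have [+ _] := fin x nCx; rewrite law_passage => -[].
move=> /eqP; rewrite -subr_eq0 addrAC subrr sub0r oppr_eq0 => /eqP e0.
move: h; apply/negP; rewrite -leNgt.
have <- : law M x (never C) = 0%E by rewrite law_never e0.
apply: le_measure; rewrite ?inE.
- rewrite (_ : mkset _ = \bigcap_n (traj M n @^-1` (~` C))).
    by apply: bigcap_measurable => // n _; exact: (measurable_traj MK).
  by apply/seteqP; split => w /= hw n; [move=> _; exact: hw|exact: (hw n I)].
- exact: measurable_never.
- by move=> w /= hw k _; exact: hw.
Qed.

Lemma sis_escapeF : semi_irreducible_stable M ->
  (forall c, exists y, 0 < esc [set c] y) -> False.
Proof.
move=> [C [[Cirr _ _] Cst]] e; have [C0 _ _] := Cirr.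
by apply: (stable_unstableF C0 Cst); apply: unstable_escape => // c _; exact: e.
Qed.

End Passage.

(** * From almost sure drift to mean increments *)

Section MeanDrift.
Context (R : realType) (S : countType) (K : fkernel R S) (M : process R S).
Hypothesis MK : markov_chain K M.

(** Almost sure convergence gives the slope outside an event of small probability; on that event the
    increments, bounded by [D], keep the contribution to the mean linear in [m] with a small
    factor. *)
Lemma mean_drift_step (f : S -> R) (D a : R) y (e : R) :
  (forall y v, v \in nbrs K y -> `|f v - f y| <= D) ->
  {ae law M y, forall w,
    (f (traj M n w) - f (traj M 0%N w)) / n%:R @[n --> \oo] --> a} ->
  0 < e ->
  exists m0, forall m, (m0 <= m)%N ->
    iter m (step K) f y <= f y + m%:R * (a + e).
Proof.
move=> fD hae e0.
have D0 : 0 <= D by exact: increment_ge0 (fD y).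
pose B m := [set v | a + e / 2 < (f v - f y) / m%:R].
pose F m := traj M m @^-1` B m.
have mF m : measurable (F m) by exact: (measurable_traj MK).
(* The bad events are centred at [f y], the convergence at the initial value of [f]; under [law M y]
   the two agree almost surely. *)
have L0 : law M y (lim_sup_set F) = 0%E.
  apply/negligibleP.
    apply: bigcap_measurable => // n _; apply: bigcup_measurable => m _; exact: mF.
  apply: (negligibleS (A :=
     [set w | ~ ((f (traj M n w) - f (traj M 0%N w)) / n%:R @[n --> \oo] --> a)]
     `|` ~` [set w | traj M 0%N w = y])).
    move=> w hw /=.
    have [w0|] := pselect (traj M 0%N w = y); last by right.
    left => cv; have := cvgr_lt a cv (a + e / 2).
    rewrite ltrDl divr_gt0// => /(_ _ isT) [N _ hN].
    have [m /= Nm] := hw N I.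
    rewrite /F /B /= -w0; apply/negP; rewrite -leNgt ltW//.
    exact: (hN m Nm).
  apply: negligibleU; first exact: hae.
  have m0 : measurable [set w | traj M 0%N w = y].
    by have [mM _ _] := MK; exact: (mM 0%N y).
  apply/negligibleP; first exact: measurableC.
  suff : law M y (~` [set w | traj M 0%N w = y]) = 0%E by [].
  by rewrite probability_setC// (law_start MK) subee.
(* On the bad event [f] exceeds the good bound by at most [m%:R * (D + |a| + 1)]; with probability
   at most [q] this costs no more than [m%:R * (e / 2)] in the mean. *)
pose q := (e / 2) / (D + `|a| + 1).
have Da1 : 0 < D + `|a| + 1 by rewrite ltr_wpDl// addr_ge0.
have q0 : 0 < q by rewrite !divr_gt0.
have : law M y (\bigcup_(k >= n) F k) @[n --> \oo] --> law M y (lim_sup_set F).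
  apply: lim_sup_set_cvg => //.
  rewrite (le_lt_trans (probability_le1 _ _)) ?ltry//.
  by apply: bigcup_measurable => m _; exact: mF.
rewrite L0 => /fine_cvgP[_] /(cvgr_lt (0 : R))/(_ q q0)[N _ hN].
have Fq m : (N <= m)%N -> iter m (step K) (fun v => (v \in B m)%:R) y <= q.
  move=> Nm; rewrite -lee_fin -(law_at MK) ltW//.
  apply: (@le_lt_trans _ _ (law M y (\bigcup_(k >= N) F k))).
    apply: le_measure; rewrite ?inE//; first exact: mF.
      by apply: bigcup_measurable => k _; exact: mF.
    by move=> w hw; exists m.
  have := hN N (leqnn N) => /=; rewrite -lte_fin fineK// fin_num_measure//.
  by apply: bigcup_measurable => k _; exact: mF.
exists (maxn N 1) => m; rewrite geq_max => /andP[Nm m1].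
have m0 : 0 < m%:R :> R by rewrite ltr0n.
apply: (@le_trans _ _ (iter m (step K) (fun v => (f y + m%:R * (a + e / 2)) +
    m%:R * (D + `|a| + 1) * (v \in B m)%:R) y)).
  apply: (iter_step_le_local fD) => v fv.
  have := le_trans (ler_norm _) fv => fv'.
  have := ler_norm (- a); rewrite normrN => aa.
  case: (boolP (v \in B m)) => [_|]; rewrite ?mulr1 ?mulr0 ?addr0.
    have : 0 <= m%:R * (a + e / 2 + `|a| + 1).
      by rewrite mulr_ge0 ?(ltW m0)//; have := e0; lra.
    lra.
  rewrite notin_setE /B /= => /negP; rewrite -leNgt ler_pdivrMr//.
  lra.
rewrite iter_stepD iter_step_cst iter_stepZ.
have : m%:R * (D + `|a| + 1) * iter m (step K) (fun v => (v \in B m)%:R) y <=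
    m%:R * (D + `|a| + 1) * q.
  by rewrite ler_wpM2l ?Fq// mulr_ge0 ?ltW.
have -> : m%:R * (D + `|a| + 1) * q = m%:R * (e / 2).
  by rewrite /q -mulrA; congr (_ * _); rewrite mulrC divfK// gt_eqF.
lra.
Qed.

End MeanDrift.

(** * Expanded and induced kernels *)

(* A module, so that the instances below do not interfere with the projection
   [val] in the statement of the theorem. *)
Module Spiral.

HB.instance Definition _ d (s : {set 'I_d} -> nat) A :=
  SubCountable.copy (expanded_state s A)
    {y : 'rV[int]_d * nat | in_expanded s A y}.

HB.instance Definition _ d (s : {set 'I_d} -> nat) A :=
  SubCountable.copy (induced_state s A)
    {y : 'rV[int]_d * nat | in_expanded s A y && (forget A y.1 == y.1)}.

Section Expanded.
Context (R : realType) (d : nat) (s : {set 'I_d} -> nat).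
Context (p : {set 'I_d} -> {set 'I_d} -> 'rV[int]_d -> nat -> nat -> R).
Local Notation raw := ('rV[int]_d * nat)%type.
Implicit Types (A : {set 'I_d}) (x z t : 'rV[int]_d) (c : raw).

(** Increments and phases that may occur on any face, each coordinate of an increment being coded by
    0, 1 or 2. Pairs leading outside the state space are dropped in [exp_nbrs]. *)
Definition moves : seq raw := undup
  [seq (\row_l ((gj.1 l : nat)%:Z - 1), gj.2) | gj : {ffun 'I_d -> 'I_3} * nat <-
    [seq (g, j) | g <- enum {: {ffun 'I_d -> 'I_3}},
                  j <- iota 0 (\max_(A : {set 'I_d}) s A).+1]].

Lemma moves_le1 z j l : (z, j) \in moves -> `|z 0 l| <= 1.
Proof.
rewrite mem_undup => /mapP[[f j'] _ [-> _]]; rewrite mxE /=.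
by case: (f l) => -[|[|[|]]].
Qed.

Lemma mem_moves z j A : (forall l, `|z 0 l| <= 1) -> (j <= s A)%N ->
  (z, j) \in moves.
Proof.
move=> z1 jA; rewrite mem_undup; apply/mapP.
exists ([ffun l => inord (absz (z 0 l + 1))], j); last first.
  congr pair; apply/rowP => l; rewrite mxE ffunE inordK.
    by have := z1 l; move: (z 0 l) => a {z1}; lia.
  by have := z1 l; move: (z 0 l) => a {z1}; lia.
apply/allpairsP; exists ([ffun l => inord (absz (z 0 l + 1))], j).
by split; rewrite ?mem_enum// mem_iota add0n ltnS (leq_trans jA)// leq_bigmax.
Qed.

Definition exp_nbrs A (y : expanded_state s A) : seq (expanded_state s A) :=
  pmap insub [seq ((val y).1 + m.1, m.2) | m <- moves].

Lemma exp_nbrs_uniq A (y : expanded_state s A) : uniq (exp_nbrs y).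
Proof.
apply: pmap_sub_uniq; rewrite map_inj_uniq ?undup_uniq//.
by move=> [z j] [z' j'] /= [/addrI -> ->].
Qed.

Lemma mem_exp_nbrs A (y v : expanded_state s A) :
  (v \in exp_nbrs y) = [forall l, `|((val v).1 - (val y).1) 0 l| <= 1].
Proof.
rewrite mem_pmap_sub; apply/mapP/forallP => [[[z j] zm ->] l|h] /=.
  by rewrite addrAC subrr add0r; exact: moves_le1 zm.
exists ((val v).1 - (val y).1, (val v).2); last first.
  by rewrite /= addrC subrK; case: (val v).
have /andP[_ /andP[_ vs]] := valP v.
exact: mem_moves vs.
Qed.

Lemma exp_out A (y v : expanded_state s A) :
  v \notin exp_nbrs y -> expanded_kernel p y v = 0.
Proof.
rewrite mem_exp_nbrs /expanded_kernel.
by case: (val y) => x i; case: (val v) => x' j /= /negbTE ->.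
Qed.

(** One-step mean on plain pairs of a position and a phase. The state spaces for different [A] are
    different types; on plain pairs the chains can be compared. *)
Definition rawstep A (F : raw -> R) c : R :=
  \sum_(m <- moves) if in_expanded s A (c.1 + m.1, m.2)
    then p (face A c.1) (face A (c.1 + m.1)) m.1 c.2 m.2 * F (c.1 + m.1, m.2)
    else 0.

Lemma big_pmap_sub A (r : seq raw) (g : expanded_state s A -> R) :
  \sum_(v <- pmap insub r) g v = \sum_(c <- r) oapp g 0 (insub c).
Proof.
elim: r => [|c r IH]; first by rewrite !big_nil.
rewrite big_cons /=; case: insub => [v|] /=; last by rewrite add0r.
by rewrite big_cons IH.
Qed.

Lemma exp_sumE A (F : raw -> R) (y : expanded_state s A) :
  \sum_(v <- exp_nbrs y) expanded_kernel p y v * F (val v) = rawstep A F (val y).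
Proof.
rewrite big_pmap_sub big_map; apply: eq_big_seq => -[z j] zm /=.
case: insubP => [v vin vE|/negbTE ->//] /=; rewrite vin /expanded_kernel.
case: y {vin} vE => -[x i] yin /=; case: v => -[x' j'] vin /= [-> ->].
by rewrite addrAC subrr add0r (introT forallP)// => l; exact: moves_le1 zm.
Qed.

(** Transition probabilities see a position only through its coordinates outside [A]; this is the
    invariance under translation along [A]. *)
Lemma eq_rawstep A F F' x x' i :
  (forall l, l \notin A -> x 0 l = x' 0 l) ->
  (forall z j, F (x + z, j) = F' (x' + z, j)) ->
  rawstep A F (x, i) = rawstep A F' (x', i).
Proof.
move=> xx' FF'; apply: eq_bigr => -[z j] _ /=.
have fE x1 x2 : (forall l, l \notin A -> x1 0 l = x2 0 l) -> face A x1 = face A x2.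
  move=> x12; apply/setP => l; rewrite !inE.
  by have [//|/x12 ->] := boolP (l \in A).
have E : in_expanded s A (x + z, j) = in_expanded s A (x' + z, j).
  rewrite /in_expanded /=; congr andb.
    apply: eq_forallb => l; have [//|lA] := boolP (l \in A).
    by rewrite !mxE xx'.
  by rewrite (fE _ (x' + z))// => l lA; rewrite !mxE xx'.
rewrite E (fE x x')// (fE (x + z) (x' + z)) ?FF'// => l lA.
by rewrite !mxE xx'.
Qed.

Lemma iter_rawstep_shift A n F x t i : (forall l, l \notin A -> t 0 l = 0) ->
  iter n (rawstep A) F (x + t, i) =
  iter n (rawstep A) (fun c => F (c.1 + t, c.2)) (x, i).
Proof.
move=> tA; elim: n x i => // n IH x i; rewrite !iterS; apply: eq_rawstep.
  by move=> l lA; rewrite mxE tA// addr0.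
by move=> z j; rewrite addrAC IH.
Qed.

(** The coordinates in [A'] but not in [A] exceed 1 and are still positive after one step, so both
    chains see the same faces before and after it. *)
Lemma rawstep_local A A' F F' x i : A \subset A' ->
  (forall l, l \in A' -> l \notin A -> 1 < x 0 l) ->
  (forall z j, (forall l, `|z 0 l| <= 1) -> F (x + z, j) = F' (x + z, j)) ->
  rawstep A F (x, i) = rawstep A' F' (x, i).
Proof.
move=> AA' xA FF'; apply: eq_big_seq => -[z j] zm /=.
have z1 l : `|z 0 l| <= 1 by exact: moves_le1 zm.
have fE x1 : (forall l, l \in A' -> l \notin A -> 0 < x1 0 l) ->
    face A x1 = face A' x1.
  move=> x1A; apply/setP => l; rewrite !inE.
  have [lA|lA] := boolP (l \in A); first by rewrite (fintype.subsetP AA').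
  by have [lA'|//] := boolP (l \in A'); rewrite /= x1A.
have xzA l : l \in A' -> l \notin A -> 0 < (x + z) 0 l.
  move=> lA' lA; rewrite mxE; have := xA l lA' lA; have := z1 l.
  by move: (x 0 l) (z 0 l) => a b; clear; lia.
have E : in_expanded s A (x + z, j) = in_expanded s A' (x + z, j).
  rewrite /in_expanded /= fE//; congr andb; apply: eq_forallb => l.
  have [lA|lA] := boolP (l \in A); first by rewrite (fintype.subsetP AA').
  by have [lA'|//] := boolP (l \in A'); rewrite ltW ?xzA.
rewrite E fE ?fE ?FF'// => l lA' lA.
by rewrite (lt_trans _ (xA l lA' lA)).
Qed.

Lemma iter_rawstep_local A A' n F x i : A \subset A' ->
  (forall l, l \in A' -> l \notin A -> n%:Z < x 0 l) ->
  iter n (rawstep A) F (x, i) = iter n (rawstep A') F (x, i).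
Proof.
move=> AA'; elim: n x i => // n IH x i xA; rewrite !iterS.
apply: rawstep_local => // [l lA' lA|z j z1].
  by have := xA l lA' lA; move: (x 0 l) => a; clear; lia.
apply: IH => l lA' lA; rewrite mxE.
by have := xA l lA' lA; have := z1 l; move: (x 0 l) (z 0 l) => a b; clear; lia.
Qed.

Context (p_ge0 : forall A (y v : expanded_state s A), 0 <= expanded_kernel p y v).
Context (p_sum : forall A (y : expanded_state s A),
  \sum_(v <- exp_nbrs y) expanded_kernel p y v = 1).

Definition expK A : fkernel R (expanded_state s A) :=
  FKernel (@exp_nbrs_uniq A) (@p_ge0 A) (@exp_out A) (@p_sum A).

Lemma step_val A F (y : expanded_state s A) :
  step (expK A) (F \o val) y = rawstep A F (val y).
Proof. exact: exp_sumE. Qed.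

Lemma iter_step_val A n F (y : expanded_state s A) :
  iter n (step (expK A)) (F \o val) y = iter n (rawstep A) F (val y).
Proof.
elim: n y => // n IH y; rewrite !iterS -step_val; apply: eq_step => v _.
exact: IH.
Qed.

Lemma eq_iter_step_val A A' n F (y : expanded_state s A) (y' : expanded_state s A') :
  A \subset A' -> val y = val y' ->
  (forall l, l \in A' -> l \notin A -> n%:Z < (val y).1 0 l) ->
  iter n (step (expK A)) (F \o val) y = iter n (step (expK A')) (F \o val) y'.
Proof.
move=> AA' yy' yA; rewrite !iter_step_val -yy'.
by case: (val y) yA => x i /= yA; exact: iter_rawstep_local.
Qed.

(** * The induced kernel *)

Lemma val_to_induced A (y : expanded_state s A) :
  val (to_induced y) = (forget A (val y).1, (val y).2).
Proof. by []. Qed.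

Lemma val_of_induced A (u : induced_state s A) : val (of_induced u) = val u.
Proof. by []. Qed.

Lemma of_inducedK A (u : induced_state s A) : to_induced (of_induced u) = u.
Proof.
apply: val_inj; rewrite val_to_induced val_of_induced.
by have /andP[_ /eqP ->] := valP u; case: (val u).
Qed.

Definition indlift A (G : induced_state s A -> R) c : R :=
  oapp G 0 (insub (forget A c.1, c.2)).

Lemma indlift_val A (G : induced_state s A -> R) :
  indlift G \o val = G \o @to_induced d s A.
Proof.
apply/funext => y; rewrite /indlift /=.
have -> : insub (forget A (val y).1, (val y).2) = Some (to_induced y).
  by rewrite -val_to_induced valK.
by [].
Qed.

Definition ind_nbrs A (u : induced_state s A) : seq (induced_state s A) :=
  undup [seq to_induced y | y <- exp_nbrs (of_induced u)].

Definition ind_trans A (u v : induced_state s A) : R :=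
  \sum_(y <- exp_nbrs (of_induced u))
    expanded_kernel p (of_induced u) y * (to_induced y == v)%:R.

Lemma ind_trans_ge0 A (u v : induced_state s A) : 0 <= ind_trans u v.
Proof. by apply: sumr_ge0 => y _; rewrite mulr_ge0. Qed.

Lemma ind_trans_out A (u v : induced_state s A) :
  v \notin ind_nbrs u -> ind_trans u v = 0.
Proof.
rewrite mem_undup => vu; rewrite /ind_trans big_seq big1// => y yu.
case: eqP => [yv|_]; last by rewrite mulr0.
by move: vu; rewrite -yv map_f.
Qed.

Lemma ind_step_sum A (G : induced_state s A -> R) u :
  \sum_(v <- ind_nbrs u) ind_trans u v * G v =
  step (expK A) (G \o @to_induced d s A) (of_induced u).
Proof.
rewrite /ind_trans; under eq_bigr do rewrite big_distrl /=.
rewrite exchange_big /step /=; apply: eq_big_seq => y yu.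
rewrite (bigD1_seq (to_induced y)) ?undup_uniq ?mem_undup ?map_f//= eqxx mulr1.
rewrite big1 ?addr0// => v; rewrite eq_sym => /negbTE ->.
by rewrite mulr0 mul0r.
Qed.

Lemma ind_trans_sum A (u : induced_state s A) :
  \sum_(v <- ind_nbrs u) ind_trans u v = 1.
Proof.
transitivity (\sum_(v <- ind_nbrs u) ind_trans u v * (fun=> 1) v).
  by apply: eq_bigr => v _; rewrite mulr1.
by rewrite ind_step_sum -[RHS](step_cst (expK A) 1 (of_induced u)).
Qed.

Definition indK A : fkernel R (induced_state s A) :=
  FKernel (fun u => undup_uniq _) (@ind_trans_ge0 A) (@ind_trans_out A) (@ind_trans_sum A).

(** Lumpability: by translation invariance along [A], the mean of a function of the induced state
    depends on the induced state alone. *)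
Lemma step_lift A (G : induced_state s A -> R) y :
  step (expK A) (G \o @to_induced d s A) y = step (indK A) G (to_induced y).
Proof.
rewrite [RHS]ind_step_sum -indlift_val !step_val val_of_induced val_to_induced.
case: (val y) => x i /=; apply: eq_rawstep => [l lA|z j].
  by rewrite mxE (negbTE lA).
rewrite /indlift /=; congr (oapp _ _ (insub (_, _))).
by apply/rowP => l; rewrite !mxE; case: ifP.
Qed.

Lemma iter_step_lift A n (G : induced_state s A -> R) y :
  iter n (step (expK A)) (G \o @to_induced d s A) y =
  iter n (step (indK A)) G (to_induced y).
Proof.
elim: n y => // n IH y; rewrite !iterS -step_lift; apply: eq_step => v _.
exact: IH.
Qed.

Lemma visits_lift A n (G : induced_state s A -> R) y :
  visits (expK A) (G \o @to_induced d s A) n y = visits (indK A) G n (to_induced y).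
Proof.
elim: n y => // n IH y; rewrite !visitsS -step_lift /=; congr (_ + _).
by apply: eq_step => v _; exact: IH.
Qed.

Lemma cyl_lift A n (B : nat -> set (induced_state s A)) y :
  cyl (expK A) n (fun k => @to_induced d s A @^-1` B k) y =
  cyl (indK A) n B (to_induced y).
Proof.
elim: n B y => [|n IH] B y /=; congr (_ * _) => //.
by rewrite -step_lift; apply: eq_step => v _; exact: IH.
Qed.

End Expanded.

Lemma cyl_path (R : realType) (S : countType) (K : fkernel R S) n (u : nat -> S) y :
  cyl K n.+1 (fun k => [set u k]) y =
  cyl K n (fun k => [set u k]) y * K (u n) (u n.+1).
Proof.
elim: n u y => [|n IH] u y.
  rewrite /= mulr1; have [/set_mem /= ->|//] := boolP (y \in [set u 0%N]); last by rewrite !mul0r.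
  rewrite !mul1r /step; have [uu|uu] := boolP (u 1%N \in nbrs K (u 0%N)).
    rewrite (bigD1_seq (u 1%N)) ?nbrs_uniq//= mem_set//= !mulr1 big1 ?addr0// => v vu.
    rewrite memNset ?mul0r ?mulr0//=; exact/eqP.
  rewrite trans_out// big_seq big1// => v vu; rewrite memNset ?mul0r ?mulr0//=.
  by move=> vu1; rewrite -vu1 vu in uu.
rewrite [LHS]/= [cyl K n.+1 _ y]/= -mulrA; congr (_ * _).
rewrite mulrC -stepZ; apply: eq_step => v _.
by rewrite [RHS]mulrC; exact: (IH (fun k => u k.+1) v).
Qed.

(** Path probabilities of the induced process are cylinder probabilities of the expanded chain,
    which lumpability turns into those of [indK]. *)
Lemma induced_markov (R : realType) d (s : {set 'I_d} -> nat) p p_ge0 p_sum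
    A (M : process R (expanded_state s A)) :
  markov_chain (@expanded_kernel R d s p A) M ->
  markov_chain (@indK R d s p p_ge0 p_sum A) (induced_process M).
Proof.
move=> MM; have MK : markov_chain (expK p_ge0 p_sum A) M by [].
have cylE x n (u : nat -> induced_state s A) :
    law (induced_process M) x
      [set w | forall k, (k <= n)%N -> traj (induced_process M) k w = u k] =
    (cyl (indK p_ge0 p_sum A) n (fun k => [set u k]) x)%:E.
  have := law_cyl MK (of_induced x) n (fun k => @to_induced d s A @^-1` [set u k]).
  by rewrite cyl_lift of_inducedK.
split => [n y|x|x n u].
- exact: (measurable_traj MM n (@to_induced d s A @^-1` [set y])).
- apply/eqP; rewrite eq_le probability_le1/=; last first.
    exact: (measurable_traj MM 0 (@to_induced d s A @^-1` [set x])).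
  have <- := law_start MM (of_induced x).
  apply: le_measure; rewrite ?inE.
  + by have [mM _ _] := MM; exact: (mM 0%N).
  + exact: (measurable_traj MM 0 (@to_induced d s A @^-1` [set x])).
  + by move=> w /= ->; rewrite of_inducedK.
- by rewrite !cylE cyl_path EFinM.
Qed.

(** * Linear functionals *)

Section Drift.
Context (R : realType) (d : nat) (s : {set 'I_d} -> nat).
Context (p : {set 'I_d} -> {set 'I_d} -> 'rV[int]_d -> nat -> nat -> R).
Context (p_ge0 : forall A (y v : expanded_state s A), 0 <= expanded_kernel p y v).
Context (p_sum : forall A (y : expanded_state s A),
  \sum_(v <- exp_nbrs y) expanded_kernel p y v = 1).
Local Notation raw := ('rV[int]_d * nat)%type.
Local Notation K := (expK p_ge0 p_sum).
Local Notation IK := (indK p_ge0 p_sum).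
Implicit Types (A : {set 'I_d}) (x t : 'rV[int]_d) (c : raw) (w : 'I_d -> R).

Definition lin w c : R := \sum_l w l * (c.1 0 l)%:~R.

Lemma linB w c c' : lin w c - lin w c' = \sum_l w l * (c.1 0 l - c'.1 0 l)%:~R.
Proof.
rewrite /lin -sumrB; apply: eq_bigr => l _.
by rewrite intrB mulrBr.
Qed.

Lemma lin_opp w c : lin (fun l => - w l) c = - lin w c.
Proof. by rewrite /lin -sumrN; apply: eq_bigr => l _; rewrite mulNr. Qed.

Definition norm1 w : R := \sum_l `|w l|.

Lemma norm1_ge0 w : 0 <= norm1 w. Proof. exact: sumr_ge0. Qed.

Lemma lin_nbrs A w (y v : expanded_state s A) :
  v \in nbrs (K A) y -> `|lin w (val v) - lin w (val y)| <= norm1 w.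
Proof.
rewrite mem_exp_nbrs => /forallP h; rewrite linB.
apply: (le_trans (ler_norm_sum _ _ _)); apply: ler_sum => l _.
rewrite normrM ler_piMr// -intr_norm lerz1.
by have := h l; rewrite !mxE.
Qed.

Lemma lin_le_norm1 w c (N : R) : (forall l, `|(c.1 0 l)%:~R| <= N) -> `|lin w c| <= norm1 w * N.
Proof.
move=> h; apply: (le_trans (ler_norm_sum _ _ _)); rewrite /norm1 mulr_suml.
by apply: ler_sum => l _; rewrite normrM ler_wpM2l.
Qed.

(** The two states differ by a translation along [A], which changes [lin w] by a constant; this
    cancels in the increment. *)
Lemma lin_face A w (y y' : expanded_state s A) : to_induced y = to_induced y' ->
  forall m, iter m (step (K A)) (lin w \o val) y - lin w (val y) =
            iter m (step (K A)) (lin w \o val) y' - lin w (val y').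
Proof.
move=> /(congr1 val); rewrite !val_to_induced => -[].
move=> fyy' iyy' m.
pose t := (val y').1 - (val y).1.
have tA l : l \notin A -> t 0 l = 0.
  move=> lA; have := congr1 (fun x : 'rV[int]_d => x 0 l) fyy'.
  by rewrite /t !mxE (negbTE lA) => ->; rewrite subrr.
have yt : val y' = ((val y).1 + t, (val y).2).
  by rewrite /t addrC subrK iyy' -surjective_pairing.
have linE c : lin w (c.1 + t, c.2) = lin w c + (lin w (val y') - lin w (val y)).
  rewrite linB /lin -big_split; apply: eq_bigr => l _.
  by rewrite /t [(_, _).1]/= !mxE [in LHS]intrD [LHS]mulrDr.
rewrite [in RHS](@iter_step_val _ _ _ _ p_ge0 p_sum) {1}yt iter_rawstep_shift//.
rewrite -surjective_pairing -(@iter_step_val _ _ _ _ p_ge0 p_sum).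
rewrite (@eq_iter_step _ _ (K A) m ((fun c => lin w (c.1 + t, c.2)) \o val)
  (fun v => (lin w \o val) v + (lin w (val y') - lin w (val y)))) => [|v]; last exact: linE.
rewrite iter_stepD iter_step_cst; lra.
Qed.

Definition sinks w A : Prop := forall B : R, exists N, forall m, (N <= m)%N ->
  forall y : expanded_state s A,
    iter m (step (K A)) (lin w \o val) y <= lin w (val y) - B.

Lemma step_lin_le w A (y : expanded_state s A) :
  step (K A) (lin w \o val) y <= (lin w \o val) y + norm1 w.
Proof.
rewrite -[leRHS](step_cst (K A) _ y); apply: step_le => v vy /=.
by have := le_trans (ler_norm _) (lin_nbrs w vy); lra.
Qed.

(** Common core of two cases: [F] is a bounded region off [A] when the induced chain is transient,
    and empty when it is stable. *)
Lemma sinks_visits w A (F : pred (expanded_state s A)) N (V : R) :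
  (forall y, ~~ F y -> exists k, [/\ (0 < k)%N, (k <= N)%N &
     iter k (step (K A)) (lin w \o val) y <= lin w (val y) - 1]) ->
  (forall m y, visits (K A) (fun v => (F v)%:R) m y <= V) ->
  sinks w A.
Proof.
move=> hF hV B.
pose e : R := (N.+1%:R)^-1.
have e0 : 0 < e by rewrite invr_gt0 ltr0n.
pose H := norm1 w + e.
have H0 : 0 <= H by rewrite addr_ge0 ?norm1_ge0 ?ltW.
(* From this time on [e * m%:R] is at least [B] plus the two error terms of [drift_visits]. *)
pose m0 := Num.Def.archi_bound `|N.+1%:R * (B + H * N%:R + H * V)|.
exists m0 => m m0m y.
have hk z : ~~ F z -> exists k, [/\ (0 < k)%N, (k <= N)%N &
    iter k (step (K A)) (lin w \o val) z <= (lin w \o val) z - e * k%:R].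
  move=> /hF[k [k0 kN hk]]; exists k; split => //; apply: (le_trans hk).
  rewrite lerD2l lerN2 /e mulrC ler_pdivrMr ?ltr0n// mul1r ler_nat.
  exact: leq_trans kN _.
apply: (le_trans (drift_visits m y (norm1_ge0 w) (ltW e0) (@step_lin_le w A) hk)).
rewrite -/H /=.
have hVm : H * visits (K A) (fun v => (F v)%:R) m y <= H * V by rewrite ler_wpM2l.
have : N.+1%:R * (B + H * N%:R + H * V) <= m%:R.
  rewrite (le_trans (ler_norm _))// ltW// (lt_le_trans (archi_boundP _))//.
  by rewrite ler_nat.
rewrite mulrC -ler_pdivlMr ?ltr0n// -/e [_ * e]mulrC.
lra.
Qed.

(** While the coordinates in [A'] but not in [A] exceed the number of steps, the chain with index
    [A] moves exactly as the one with index [A']. *)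
Lemma sinks_local w A A' (B : R) : A \subset A' -> sinks w A' ->
  exists N, forall m, (N <= m)%N -> forall y : expanded_state s A,
    (forall l, l \in A' -> l \notin A -> m%:Z < (val y).1 0 l) ->
    iter m (step (K A)) (lin w \o val) y <= lin w (val y) - B.
Proof.
move=> AA' /(_ B)[N hN]; exists N => m Nm y yA.
have yA' : in_expanded s A' (val y).
  have /andP[/forallP h1 h2] := valP y.
  have pos l : l \in A' -> l \notin A -> 0 < (val y).1 0 l.
    by move=> lA' lA; have := yA l lA' lA; move: ((val y).1 0 l) => a; clear; lia.
  apply/andP; split.
    apply/forallP => l; apply/implyP => lA'; have /implyP := h1 l; apply.
    by apply: contra lA'; exact: (fintype.subsetP AA').
  suff <- : face A (val y).1 = face A' (val y).1 by [].
  apply/setP => l; rewrite !inE.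
  have [lA|lA] := boolP (l \in A); first by rewrite (fintype.subsetP AA').
  by have [lA'|//] := boolP (l \in A'); rewrite pos.
rewrite (@eq_iter_step_val _ _ _ _ p_ge0 p_sum A A' m (lin w) y (Sub (val y) yA'))//.
exact: hN.
Qed.

Lemma sinks_faces w A : (forall l, l \notin A -> sinks w (l |: A)%SET) ->
  exists N, (0 < N)%N /\ forall y : expanded_state s A,
    (exists l, l \notin A /\ N%:Z < (val y).1 0 l) ->
    iter N (step (K A)) (lin w \o val) y <= lin w (val y) - 1.
Proof.
move=> h.
have [|N hN] := @seq_unif 'I_d (enum 'I_d) (fun l m => l \notin A ->
    forall y : expanded_state s A, m%:Z < (val y).1 0 l ->
    iter m (step (K A)) (lin w \o val) y <= lin w (val y) - 1).
  move=> l _; have [lA|lA] := boolP (l \in A); first by exists 0%N.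
  have [N hN] := sinks_local 1 (finset.subsetUr [set l] A) (h l lA).
  exists N => m Nm _ y ym; apply: hN => // l'; rewrite !inE => /orP[/eqP ->//|->//].
exists N.+1; split=> // y [l [lA lN]].
by apply: (hN N.+1 l (leqnSn N)) => //; rewrite mem_enum.
Qed.

Definition box N : seq raw := [seq (\row_l (gj.1 l : nat)%:Z, gj.2) |
  gj : {ffun 'I_d -> 'I_N.+1} * nat <-
    [seq (g, j) | g <- enum {: {ffun 'I_d -> 'I_N.+1}},
                  j <- iota 0 (\max_(A : {set 'I_d}) s A).+1]].

Lemma mem_box N A x j : (forall l, 0 <= x 0 l <= N%:Z) -> (j <= s A)%N ->
  (x, j) \in box N.
Proof.
move=> xN jA; apply/mapP.
exists ([ffun l => inord (absz (x 0 l))], j); last first.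
  congr pair; apply/rowP => l; rewrite mxE ffunE inordK.
    by have := xN l; move: (x 0 l) => a; clear; lia.
  by have := xN l; move: (x 0 l) => a; clear; lia.
apply/allpairsP; exists ([ffun l => inord (absz (x 0 l))], j).
by split; rewrite ?mem_enum// mem_iota add0n ltnS (leq_trans jA)// leq_bigmax.
Qed.

Lemma mem_induced_box N A (y : expanded_state s A) :
  (forall l, l \notin A -> (val y).1 0 l <= N%:Z) ->
  to_induced y \in (pmap insub (box N) : seq (induced_state s A)).
Proof.
move=> yN; rewrite mem_pmap_sub val_to_induced.
have /andP[/forallP h1 /andP[_ h2]] := valP y.
apply: mem_box h2 => l; rewrite mxE; case: ifPn => lA; first by rewrite lexx.
by rewrite yN// andbT; have := h1 l; rewrite lA.
Qed.

Lemma mem_expanded_box N (y : expanded_state s finset.set0) :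
  (forall l, (val y).1 0 l <= N%:Z) ->
  y \in (pmap insub (box N) : seq (expanded_state s finset.set0)).
Proof.
move=> yN; rewrite mem_pmap_sub.
have /andP[/forallP h1 /andP[_ h2]] := valP y.
rewrite [val y]surjective_pairing; apply: mem_box h2 => l.
by rewrite yN andbT; have := h1 l; rewrite inE.
Qed.

(** Where no face of larger index gives the decrease, the induced state lies in a finite box, and
    each of its states is visited a bounded mean number of times. *)
Lemma sinks_transient w A (M : process R (expanded_state s A)) :
  markov_chain (expanded_kernel p (A:=A)) M -> transient_chain (induced_process M) ->
  (forall l, l \notin A -> sinks w (l |: A)%SET) -> sinks w A.
Proof.
move=> MM tr faces.
have IM := @induced_markov _ _ _ _ p_ge0 p_sum _ _ MM.
have [N [N0 hN]] := sinks_faces faces.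
pose F (y : expanded_state s A) := [forall l, (l \notin A) ==> ((val y).1 0 l <= N%:Z)].
pose r := undup (pmap insub (box N) : seq (induced_state s A)).
pose q (u : induced_state s A) := esc (induced_process M) [set u] u.
apply: (@sinks_visits w A F N (\sum_(u <- r) (1 + (q u)^-1))) => [y|m y].
  rewrite negb_forall => /existsP[l]; rewrite negb_imply -ltNge => /andP[lA lN].
  by exists N; split=> //; apply: hN; exists l.
apply: (@le_trans _ _ (visits (K A)
    (fun v => \sum_(u <- r) (to_induced v == u)%:R) m y)).
  apply: visits_le => v; have [/forallP Fv|_] := boolP (F v); last first.
    by rewrite sumr_ge0.
  have vr : to_induced v \in r.
    rewrite mem_undup; apply: mem_induced_box => l lA; have := Fv l.
    by rewrite lA.
  rewrite (bigD1_seq (to_induced v)) ?undup_uniq//= eqxx lerDl.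
  by apply: sumr_ge0.
rewrite visits_sum; apply: ler_sum => u _.
rewrite -/((fun v => (v == u)%:R) \o @to_induced d s A) visits_lift.
apply: visits_transient; first exact/(transient_stateP IM).
by move=> n; exact: (esc_le IM).
Qed.

Lemma lin_mean_drift w A (M : process R (expanded_state s A)) (a : 'rV[R]_d) y :
  mean_drift M a ->
  {ae law M y, forall v, (lin w (val (traj M n v)) - lin w (val (traj M 0%N v))) / n%:R
     @[n --> \oo] --> \sum_l w l * a 0 l}.
Proof.
move=> /(_ y); apply: filterS => v h.
have -> : (fun n => (lin w (val (traj M n v)) - lin w (val (traj M 0%N v))) / n%:R) =
   fun n => \sum_l w l * (((val (traj M n v)).1 0 l - (val (traj M 0%N v)).1 0 l)%:~R / n%:R).
  apply/funext => n; rewrite linB mulr_suml.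
  by apply: eq_bigr => l _; rewrite mulrA.
apply: cvg_big => [|l _]; first exact: add_continuous.
exact: cvgMl_tmp.
Qed.

Lemma iter_lin_mean_drift w A (M : process R (expanded_state s A)) (a : 'rV[R]_d) y (e : R) :
  markov_chain (expanded_kernel p (A:=A)) M -> mean_drift M a -> 0 < e ->
  exists m0, forall m, (m0 <= m)%N -> iter m (step (K A)) (lin w \o val) y <=
    lin w (val y) + m%:R * (\sum_l w l * a 0 l + e).
Proof.
move=> MM hM e0.
exact: (@mean_drift_step _ _ (K A) M MM (lin w \o val) (norm1 w) _ y e
  (@lin_nbrs A w) (lin_mean_drift w y hM) e0).
Qed.

(** In the finite box of induced states the drift vector yields one time [m1] that works for all of
    them, and [lin_face] carries the decrease to every position along [A]. *)
Lemma sinks_stable w A (M : process R (expanded_state s A)) (a : 'rV[R]_d) :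
  markov_chain (expanded_kernel p (A:=A)) M -> mean_drift M a ->
  \sum_l w l * a 0 l < 0 ->
  (forall l, l \notin A -> sinks w (l |: A)%SET) -> sinks w A.
Proof.
move=> MM hM wa faces.
have [N [N0 hN]] := sinks_faces faces.
pose a0 := \sum_l w l * a 0 l.
have a00 : 0 < - a0 / 2 by rewrite divr_gt0// oppr_gt0.
have [|m0 hm0] := @seq_unif _ (pmap insub (box N) : seq (induced_state s A))
    (fun u m => iter m (step (K A)) (lin w \o val) (of_induced u) <=
      lin w (val (of_induced u)) + m%:R * (a0 + - a0 / 2)).
  by move=> u _; exact: (iter_lin_mean_drift w (of_induced u) MM hM a00).
(* Half of the negative drift [a0] is given up as the error of the mean; [m1] makes the other half
   accumulate to at least 1. *)
pose m1 := maxn m0 (Num.Def.archi_bound `|(- a0 / 2)^-1|).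
have m1a : m1%:R * (a0 + - a0 / 2) <= -1.
  have : (- a0 / 2)^-1 <= m1%:R.
    rewrite (le_trans (ler_norm _))// ltW// (lt_le_trans (archi_boundP _))//.
    by rewrite ler_nat leq_maxr.
  rewrite -(ler_pM2r a00) mulVf ?gt_eqF//; lra.
have m10 : (0 < m1)%N.
  by rewrite lt0n; apply/eqP => m10; move: m1a; rewrite m10 mul0r; lra.
apply: (@sinks_visits w A xpred0 (maxn N m1) 0) => [y _|m y]; last first.
  rewrite /= mulr0n; elim: m y => // m IH y; rewrite visitsS add0r.
  by rewrite -[leRHS](step_cst (K A) 0 y); apply: step_le => v _; exact: IH.
have [F|] := boolP [forall l, (l \notin A) ==> ((val y).1 0 l <= N%:Z)]; last first.
  rewrite negb_forall => /existsP[l]; rewrite negb_imply -ltNge => /andP[lA lN].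
  by exists N; split; rewrite ?leq_maxl//; apply: hN; exists l.
exists m1; split; rewrite ?leq_maxr//.
have yr : to_induced y \in (pmap insub (box N) : seq (induced_state s A)).
  by apply: mem_induced_box => l lA; move/forallP/(_ l): F; rewrite lA.
have := hm0 m1 _ (leq_maxl _ _) yr.
have := @lin_face A w y (of_induced (to_induced y)) _ m1; rewrite of_inducedK => /(_ erefl).
rewrite /comp; lra.
Qed.

End Drift.

(** * Drift along the boundary *)

Lemma nat_above (R : archiRealFieldType) (x : R) : exists n : nat, x <= n%:R.
Proof.
exists (Num.Def.archi_bound `|x|).
by rewrite (le_trans (ler_norm _))// ltW// archi_boundP.
Qed.

Section Boundary.
Context (R : realType) (d : nat) (s : {set 'I_d} -> nat).
Context (hs : forall A, (0 < s A)%N).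
Context (p : {set 'I_d} -> {set 'I_d} -> 'rV[int]_d -> nat -> nat -> R).
Context (p_ge0 : forall A (y v : expanded_state s A), 0 <= expanded_kernel p y v).
Context (p_sum : forall A (y : expanded_state s A),
  \sum_(v <- exp_nbrs y) expanded_kernel p y v = 1).
Local Notation K := (expK p_ge0 p_sum).
Local Notation IK := (indK p_ge0 p_sum).
Local Notation sinks := (sinks p_ge0 p_sum).
Implicit Types (A : {set 'I_d}) (x t : 'rV[int]_d) (w : 'I_d -> R).

Lemma expanded_at A x : (forall l, l \notin A -> 0 <= x 0 l) ->
  exists y : expanded_state s A, (val y).1 = x.
Proof.
move=> x0; have xin : in_expanded s A (x, 1%N).
  apply/andP; split; last by rewrite /= hs.
  by apply/forallP => l; apply/implyP; exact: x0.
by exists (Sub (x, 1%N) xin); rewrite SubK.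
Qed.

(** A transient induced chain would make [w] sink, which a lower bound on its means forbids. This
    serves to exclude transience. *)
Lemma transientF w A (M : process R (expanded_state s A)) (b : R) y :
  markov_chain (expanded_kernel p (A:=A)) M -> transient_chain (induced_process M) ->
  (forall l, l \notin A -> sinks w (l |: A)%SET) ->
  ~ forall m, b <= iter m (step (K A)) (lin w \o val) y.
Proof.
move=> MM tr faces hb.
have [N hN] := sinks_transient MM tr faces (lin w (val y) - b + 1).
by have := hN N (leqnn N) y; have := hb N; lra.
Qed.

Definition unitw (k l : 'I_d) : R := (l == k)%:R.

Lemma sum_unitw k (a : 'I_d -> R) : \sum_l unitw k l * a l = a k.
Proof.
rewrite (bigD1 k)//= /unitw eqxx mul1r big1 ?addr0// => l /negbTE ->.
by rewrite mul0r.
Qed.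

Lemma lin_unitw k c : lin (unitw k) c = (c.1 0 k)%:~R.
Proof. exact: sum_unitw. Qed.

Lemma coord_ge0 A k (y : expanded_state s A) : k \notin A -> 0 <= (val y).1 0 k.
Proof.
by move=> kA; have /andP[/forallP/(_ k)] := valP y; rewrite kA.
Qed.

Lemma iter_coord_ge0 A k m (y : expanded_state s A) : k \notin A ->
  0 <= iter m (step (K A)) (lin (unitw k) \o val) y.
Proof.
move=> kA; rewrite -(iter_step_cst (K A) m 0 y); apply: iter_step_le => v /=.
by rewrite lin_unitw ler0z coord_ge0.
Qed.

Lemma norm1_unitw k : norm1 (unitw k) = 1.
Proof.
rewrite /norm1 (eq_bigr (fun l => unitw k l * (fun=> 1) l)) ?sum_unitw// => l _.
by rewrite mulr1 ger0_norm// ler0n.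
Qed.

(* The second moment of the [k]-th coordinate grows at most linearly, so its
   mean is [o(n)]. *)
Lemma mean_drift_orth A (M : process R (expanded_state s A)) (a : 'rV[R]_d) k :
  markov_chain (expanded_kernel p (A:=A)) M -> mean_drift M a ->
  k \notin A -> sinks (unitw k) (k |: A)%SET -> a 0 k = 0.
Proof.
move=> MM hM kA sk.
have [y _] := @expanded_at A 0 (fun l _ => ltac:(by rewrite mxE)).
set f := lin (unitw k) \o val : expanded_state s A -> R.
have f0 v : 0 <= f v by rewrite /f /= lin_unitw ler0z coord_ge0.
have iterf0 m v : 0 <= iter m (step (K A)) f v by exact: iter_coord_ge0.
(* A positive drift is refuted by the second moment; a negative one, at the end, by nonnegativity of
   the coordinate. *)
apply/eqP; rewrite eq_le; apply/andP; split; rewrite leNgt; apply/negP => ak.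
  have [N hN] := sinks_local 0 (finset.subsetUr [set k] A) sk.
  have [N0 hN0] : exists N, (0 < N)%N /\ forall v, N%:R < f v ->
      iter N (step (K A)) f v <= f v.
    exists N.+1; split=> // v Nv; rewrite -[leRHS]subr0; apply: hN => // l.
    rewrite !inE => /orP[/eqP -> _|->//].
    by move: Nv; rewrite /f /= lin_unitw -[N.+1%:R]/(N.+1%:Z%:~R) ltr_int.
  move=> {N hN}; move: N0 hN0 => N [N0 hN].
  (* Over [N] steps the square gains at most [N%:R ^+ 2] plus twice [f v] times the mean increment.
     Above [N] this increment is nonpositive; below, the product is at most [2 * N%:R ^+ 2]. *)
  pose b : R := 3 * N%:R ^+ 2.
  have sq v : iter N (step (K A)) (fun v => f v ^+ 2) v <= f v ^+ 2 + b.
    apply: (@le_trans _ _ (iter N (step (K A)) (fun u => 2 * f v * f u +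
        (N%:R ^+ 2 - f v ^+ 2)) v)).
      apply: (iter_step_le_local (f := f) (D := 1)).
        by move=> y' v' hv'; rewrite -(norm1_unitw k); exact: lin_nbrs hv'.
      move=> u; rewrite mul1r => uv.
      have : (f u - f v) ^+ 2 <= N%:R ^+ 2.
        by rewrite -(real_normK (num_real _)) ler_sqr ?nnegrE.
      lra.
    rewrite iter_stepD iter_stepZ iter_step_cst.
    have [vN|Nv] := leP (f v) N%:R; last first.
      have := hN v Nv; have := f0 v; rewrite /b; nra.
    have : iter N (step (K A)) f v <= f v + 1 * N%:R.
      apply: iter_step_drift => u; rewrite -(norm1_unitw k).
      exact: step_lin_le.
    by have := f0 v; have := iterf0 N v; rewrite /b; nra.
  have sqm m v : iter (N * m) (step (K A)) (fun v => f v ^+ 2) v <= f v ^+ 2 + b * m%:R.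
    elim: m v => [|m IH] v; first by rewrite muln0 mulr0 addr0.
    rewrite mulnS iter_step_addn.
    apply: (le_trans (iter_step_le (K A) N v IH)).
    rewrite iter_stepD iter_step_cst -natr1.
    by have := sq v; lra.
  have b0 : 0 <= b by rewrite mulr_ge0// sqr_ge0.
  have e0 : 0 < a 0 k / 2 by rewrite divr_gt0.
  have [m0 hm0] := iter_lin_mean_drift p_ge0 p_sum (fun l => - unitw k l) y MM hM e0.
  have N0R : 0 < N%:R :> R by rewrite ltr0n.
  (* The drift forces a mean growth of [2 * g] per [N] steps. With weight [kap], bounding [f] by its
     square allows a growth of only [g]. *)
  pose g := N%:R * a 0 k / 4.
  have g0 : 0 < g by rewrite !mulr_gt0// invr_gt0.
  pose kap := b / (2 * g) + 1.
  have kap0 : 0 < kap by rewrite ltr_wpDl// divr_ge0// mulr_ge0// ltW.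
  have bk : b / (2 * kap) <= g.
    rewrite ler_pdivrMr ?mulr_gt0// /kap.
    have -> : g * (2 * (b / (2 * g) + 1)) = b + 2 * g by field; rewrite gt_eqF.
    by rewrite lerDl mulr_ge0// ltW.
  have amgm v : f v <= (2 * kap)^-1 * f v ^+ 2 + kap / 2.
    have : 0 <= (2 * kap)^-1 * (f v - kap) ^+ 2.
      by rewrite mulr_ge0 ?sqr_ge0// invr_ge0 mulr_ge0// ltW.
    have -> : (2 * kap)^-1 * (f v - kap) ^+ 2 =
        (2 * kap)^-1 * f v ^+ 2 + kap / 2 - f v by field; rewrite gt_eqF.
    lra.
  pose c := (2 * kap)^-1 * f y ^+ 2 + kap / 2.
  have [m1 hm1] := nat_above ((c + 1) / g).
  pose m := maxn m0 m1.
  have mNm : (m0 <= N * m)%N by rewrite (leq_trans (leq_maxl m0 m1))// leq_pmull.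
  have := hm0 _ mNm.
  rewrite lin_opp (eq_bigr (fun l => - (unitw k l * a 0 l))); last first.
    by move=> l _; rewrite mulNr.
  rewrite sumrN (sum_unitw k (fun l => a 0 l)).
  rewrite (@eq_iter_step _ _ (K A) (N * m) _ (fun v => -1 * f v)); last first.
    by move=> v; rewrite /= lin_opp mulN1r.
  rewrite iter_stepZ natrM.
  have h1 : iter (N * m) (step (K A)) f y <=
      (2 * kap)^-1 * (f y ^+ 2 + b * m%:R) + kap / 2.
    apply: (le_trans (iter_step_le (K A) (N * m) y amgm)).
    rewrite iter_stepD iter_step_cst lerD2r iter_stepZ ler_wpM2l//.
    by rewrite invr_ge0 mulr_ge0// ltW.
  have h2 : (2 * kap)^-1 * (b * m%:R) <= g * m%:R.
    by rewrite mulrA [_ * b]mulrC ler_wpM2r.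
  have h3 : c + 1 <= g * m%:R.
    rewrite mulrC -ler_pdivrMr// (le_trans hm1)// ler_nat leq_maxr//.
  have fy0 := f0 y.
  have h4 : N%:R * m%:R * (- a 0 k + a 0 k / 2) = - 2 * (g * m%:R).
    by rewrite /g; field.
  by rewrite h4 -[lin (unitw k) _]/(f y); move: h1 h3; rewrite /c; lra.
have e0 : 0 < - a 0 k / 2 by rewrite divr_gt0// oppr_gt0.
have [m0 hm0] := iter_lin_mean_drift p_ge0 p_sum (unitw k) y MM hM e0.
have [m1 hm1] := nat_above ((f y + 1) / (- a 0 k / 2)).
have := hm0 _ (leq_maxl m0 m1).
rewrite (sum_unitw k (fun l => a 0 l)) -[lin (unitw k) _]/(f y).
have := iterf0 (maxn m0 m1) y.
have : f y + 1 <= (maxn m0 m1)%:R * (- a 0 k / 2).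
  by rewrite -ler_pdivrMr// (le_trans hm1)// ler_nat leq_maxr.
lra.
Qed.

Lemma lin_to_induced w A (y : expanded_state s A) : (forall l, l \in A -> w l = 0) ->
  lin w (val (to_induced y)) = lin w (val y).
Proof.
move=> wA; apply: eq_bigr => l _; rewrite val_to_induced mxE.
by case: ifP => // lA; rewrite wA// !mul0r.
Qed.

(** As [w] vanishes on [A], [- lin w] is a function of the induced state. It rises in mean wherever
    some coordinate off [A] is large, so [escape] applies to the induced chain. *)
Lemma sinks_not_stable w A (M : process R (expanded_state s A)) :
  markov_chain (expanded_kernel p (A:=A)) M ->
  (forall l, l \in A -> w l = 0) ->
  (forall l, l \notin A -> sinks w (l |: A)%SET) ->
  (forall B : R, exists y : expanded_state s A, lin w (val y) < B) ->
  ~ semi_irreducible_stable (induced_process M).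
Proof.
move=> MM wA faces low sis.
have IM := @induced_markov _ _ _ _ p_ge0 p_sum _ _ MM.
have [N [N0 hN]] := sinks_faces faces.
apply: (sis_escapeF IM sis) => c.
pose f (u : induced_state s A) := - lin w (val u).
(* Above the first level some coordinate must exceed [N]; the second is the distance from [c] that
   [escape] requires. *)
pose c0 := Num.max (norm1 w * N%:R) (f c + norm1 w * N%:R).
have [y hy] := low (- c0).
exists (to_induced y).
have fto : f \o @to_induced d s A =1 fun v => -1 * (lin w \o val) v.
  by move=> v; rewrite /= /f lin_to_induced// mulN1r.
have [||||q q0 hq] := @escape R _ (IK A) f (norm1 w) c0 N c (to_induced y).
- move=> u v; rewrite mem_undup => /mapP[v' v'u ->]; rewrite /f opprK addrC.
  rewrite lin_to_induced// -[in lin w (val u)](of_inducedK u) lin_to_induced//.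
  by rewrite distrC; exact: lin_nbrs.
- move=> u c0u; exists N; split=> //.
  have := iter_step_lift p_ge0 p_sum N f (of_induced u).
  rewrite of_inducedK => <-; rewrite (eq_iter_step _ _ _ fto) iter_stepZ.
  suff /hN : exists l, l \notin A /\ N%:Z < (val (of_induced u)).1 0 l.
    by rewrite /f val_of_induced; lra.
  apply/not_existsP => hl; move: c0u; apply/negP; rewrite -leNgt.
  rewrite le_max; apply/orP; left; rewrite (le_trans (ler_norm _))// normrN.
  apply: lin_le_norm1 => l.
  have /andP[_ /eqP uA] := valP u.
  have [lA|lA] := boolP (l \in A); first by rewrite -uA mxE lA normr0 ler0n.
  have u0 : 0 <= (val u).1 0 l by exact: (coord_ge0 (of_induced u) lA).
  rewrite ger0_norm ?ler0z// -[N%:R]/(N%:Z%:~R) ler_int leNgt; apply/negP => Nl.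
  by apply: (hl l); split.
- by rewrite le_max lexx orbT.
- by rewrite /f lin_to_induced//; move: hy; rewrite ltrNr.
- by apply: (lt_le_trans q0); exact: (le_esc IM).
Qed.

End Boundary.

(** * The reflected chain *)

Section Reflected.
Context (R : realType) (d : nat) (s : {set 'I_d} -> nat).
Context (p : {set 'I_d} -> {set 'I_d} -> 'rV[int]_d -> nat -> nat -> R).
Context (p_ge0 : forall A (y v : expanded_state s A), 0 <= expanded_kernel p y v).
Context (p_sum : forall A (y : expanded_state s A),
  \sum_(v <- exp_nbrs y) expanded_kernel p y v = 1).
Local Notation K := (expK p_ge0 p_sum).
Local Notation sinks := (sinks p_ge0 p_sum).

(** Foster's criterion with [lin w] as Lyapunov function: outside a finite box some coordinate is
    large, hence some axis gives the decrease. *)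
Lemma stable_of_sinks w (M : process R (mmrrw_state s)) (C : set (mmrrw_state s)) :
  markov_chain (mmrrw_kernel p) M -> semi_irreducible M C ->
  (forall l, 0 <= w l) -> (forall l, sinks w [set l]%SET) -> stable M C.
Proof.
move=> MM [[C0 _ _] _ acc] w0 sw.
have MK : markov_chain (K finset.set0) M by [].
have [|N [N0 hN]] := @sinks_faces _ _ _ _ p_ge0 p_sum w finset.set0.
  by move=> l _; rewrite finset.setU0; exact: sw.
have fin c y : C c -> exists W : R, forall n,
    \sum_(0 <= k < n) iter k (kill (K finset.set0) [set c]) (fun=> 1) y <= W.
  move=> Cc.
  have [|||W hW] := @foster _ _ (K finset.set0) (lin w \o val) N
      (pmap insub (box s N) : seq (expanded_state s finset.set0)) c.
  - move=> v; apply: sumr_ge0 => l _; rewrite mulr_ge0// ler0z.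
    by apply: coord_ge0; rewrite inE.
  - move=> v vN; apply: hN; apply/not_existsP => h; move/negP: vN; apply.
    apply: mem_expanded_box => l; rewrite leNgt; apply/negP => lN.
    by apply: (h l); split; rewrite ?inE.
  - move=> v _; apply: iter_kill_lt1 => u; apply/(accessibleP MK).
    exact: acc.
  by exists (W y) => n; exact: hW.
split=> [x Cx|x nCx].
  have [W hW] := fin x x Cx.
  exact: (finite_mean_passage_bounded MK hW).
(* The passage to [C] is no later than the passage to one of its states. *)
have [c Cc] := C0; have [W hW] := fin c x Cc.
apply: (finite_mean_passage_bounded (W := W) MK) => n.
apply: le_trans (hW n); apply: ler_sum => k _.
by apply: iter_kill_subset => _ ->.
Qed.

End Reflected.

Lemma ord3P (i j k : 'I_3) : i != j -> j != k -> k != i ->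
  forall l, [\/ l = i, l = j | l = k].
Proof.
move=> /eqP ij /eqP jk /eqP ki l.
have [->|/eqP li] := eqVneq l i; first by constructor 1.
have [->|/eqP lj] := eqVneq l j; first by constructor 2.
constructor 3; apply: val_inj => /=.
have nv (a b : 'I_3) : a <> b -> (a : nat) <> b by move=> ab /val_inj.
have := nv _ _ ij; have := nv _ _ jk; have := nv _ _ ki; have := nv _ _ li; have := nv _ _ lj.
move: (ltn_ord i) (ltn_ord j) (ltn_ord k) (ltn_ord l).
move: (i : nat) (j : nat) (k : nat) (l : nat); clear; lia.
Qed.

Lemma big_ord3 (R : realType) (i j k : 'I_3) (F : 'I_3 -> R) :
  i != j -> j != k -> k != i -> \sum_l F l = F i + F j + F k.
Proof.
move=> ij jk ki; rewrite (bigD1 i)//= (bigD1 j) 1?eq_sym//= (bigD1 k) /=; last first.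
  by rewrite ki eq_sym jk.
rewrite big_pred0 ?addr0 ?addrA// => l; apply/negP => /andP[/andP[li lj] lk].
by case: (ord3P ij jk ki l) => E; rewrite E eqxx in li lj lk.
Qed.

(** * Escape along the maximum of three linear forms *)

Section Spiral.
Context (R : realType) (s : {set 'I_3} -> nat) (hs : forall A, (0 < s A)%N).
Context (p : {set 'I_3} -> {set 'I_3} -> 'rV[int]_3 -> nat -> nat -> R).
Context (p_ge0 : forall A (y v : expanded_state s A), 0 <= expanded_kernel p y v).
Context (p_sum : forall A (y : expanded_state s A),
  \sum_(v <- exp_nbrs y) expanded_kernel p y v = 1).
Local Notation K := (expK p_ge0 p_sum).
Local Notation sinks := (sinks p_ge0 p_sum).

(** The maximum is attained by the form of the smallest coordinate [l]. If the other two exceed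
    [m1], that form itself rises. Otherwise two coordinates are at most [m1]; near the remaining
    axis the form given by [axes] is within [kap * m1%:R] of the maximum, and its rise is made large
    enough to cover this gap. *)
Lemma unstable_of_sinks (w : 'I_3 -> R) (kap : R)
    (M : process R (mmrrw_state s)) (C : set (mmrrw_state s)) :
  markov_chain (mmrrw_kernel p) M -> irreducible_class M C ->
  (forall l, 0 < w l) -> 0 <= kap ->
  (forall l, sinks (fun l' => - (w l' - kap * (l' == l)%:R)) [set~ l]%SET) ->
  (forall i, exists l, l != i /\
     sinks (fun l' => - (w l' - kap * (l' == l)%:R)) [set i]%SET) ->
  unstable M C.
Proof.
move=> MM Cirr w0 kap0 pairs axes.
have MK : markov_chain (K finset.set0) M by [].
pose v l l' := w l' - kap * (l' == l)%:R.
pose g l (y : expanded_state s finset.set0) := lin (v l) (val y).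
pose f y := Num.max (Num.max (g k1 y) (g k2 y)) (g k3 y).
have gE l y : g l y = lin w (val y) - kap * ((val y).1 0 l)%:~R.
  rewrite -lin_unitw /g /lin mulr_sumr -sumrB; apply: eq_bigr => l' _.
  by rewrite /v /unitw mulrBl mulrA.
have k3P := @ord3P k1 k2 k3 isT isT isT.
have gf l y : g l y <= f y.
  by rewrite /f !le_max; case: (k3P l) => ->; rewrite lexx ?orbT.
have fg y : exists l, f y = g l y.
  rewrite /f; case: (leP _ (g k3 y)) => _; first by exists k3.
  by case: (leP _ (g k2 y)) => _; [exists k2|exists k1].
have x0 (y : expanded_state s finset.set0) l : 0 <= (val y).1 0 l.
  by apply: coord_ge0; rewrite inE.
have fw y : f y <= lin w (val y).
  have [l ->] := fg y; rewrite gE gerBl mulr_ge0// ler0z//; exact: x0.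
pose D := \sum_l norm1 (v l).
have gD l y u : u \in nbrs (K finset.set0) y -> `|g l u - g l y| <= D.
  move=> uy; apply: (le_trans (lin_nbrs _ uy)).
  by rewrite /D (bigD1 l)//= lerDl; apply: sumr_ge0 => l' _; exact: norm1_ge0.
have fD y u : u \in nbrs (K finset.set0) y -> `|f u - f y| <= D.
  move=> uy; have hg l := gD l y u uy.
  have [l1 e1] := fg y; have [l2 e2] := fg u.
  have := hg l1; have := hg l2; rewrite !ler_norml => /andP[a1 a2] /andP[b1 b2].
  have := gf l1 u; have := gf l2 y; rewrite e1 e2 => h1 h2.
  by apply/andP; split; lra.
have itg l m y : iter m (step (K finset.set0)) (lin (fun l' => - v l l') \o val) y =
    - iter m (step (K finset.set0)) (g l) y.
  rewrite -mulN1r -iter_stepZ; apply: eq_iter_step => u.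
  by rewrite /= lin_opp mulN1r.
have itf l m y : iter m (step (K finset.set0)) (g l) y <= iter m (step (K finset.set0)) f y.
  by apply: iter_step_le => u; exact: gf.
have lin0 l y : lin (fun l' => - v l l') (val y) = - g l y by exact: lin_opp.
have [|n1 hn1] := @seq_unif 'I_3 (enum 'I_3) (fun l m =>
    forall y : expanded_state s finset.set0,
    (forall l', l' != l -> m%:Z < (val y).1 0 l') ->
    g l y + 1 <= iter m (step (K finset.set0)) (g l) y).
  move=> l _; have [N hN] := sinks_local 1 (finset.sub0set _) (pairs l).
  exists N => m Nm y hy; have := hN m Nm y; rewrite itg lin0.
  have h l' : l' \in [set~ l]%SET -> l' \notin (finset.set0 : {set 'I_3}) -> m%:Z < (val y).1 0 l'.
    by rewrite !inE => ll' _; exact: hy.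
  by move=> /(_ h); lra.
pose m1 := n1.+1.
have [|n2 hn2] := @seq_unif 'I_3 (enum 'I_3) (fun i m => exists l, l != i /\
    forall y : expanded_state s finset.set0, m%:Z < (val y).1 0 i ->
    g l y + (1 + kap * m1%:R) <= iter m (step (K finset.set0)) (g l) y).
  move=> i _; have [l [li sl]] := axes i.
  have [N hN] := sinks_local (1 + kap * m1%:R) (finset.sub0set _) sl.
  exists N => m Nm; exists l; split => // y hy; have := hN m Nm y; rewrite itg lin0.
  have h l' : l' \in [set i]%SET -> l' \notin (finset.set0 : {set 'I_3}) -> m%:Z < (val y).1 0 l'.
    by rewrite !inE => /eqP -> _.
  by move=> /(_ h); lra.
pose m2 := maxn m1 n2.
have m12 : (m1 <= m2)%N by exact: leq_maxl.
have m20 : (0 < m2)%N by exact: leq_trans m12.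
apply: (unstable_escape MK Cirr) => c _.
(* Above the first level some coordinate exceeds [m2]; the second is the distance required by
   [escape]. The starting state [y0] lies far out on the axis [k1], where the form of [k2] is
   [w k1 * T%:R]. *)
pose c0 := Num.max (norm1 w * m2%:R) (f c + D * m2%:R).
have [T hT] := nat_above ((c0 + 1) / w k1).
have [y0 hy0] := @expanded_at 3 s hs finset.set0
  (\row_l (if l == k1 then T%:Z else 0)) (fun l _ => ltac:(by rewrite mxE; case: eqP)).
exists y0.
have [|||q q0 hq] := @escape R _ (K finset.set0) f D c0 m2 c y0 fD.
- move=> y c0y.
  have [l lmin] : exists l, forall l', (val y).1 0 l <= (val y).1 0 l'.
    have [l _ lmin] := @arg_minP _ _ 'I_3 k1 xpredT (fun l => (val y).1 0 l) isT.
    by exists l => l'; exact: lmin.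
  have fl : f y = g l y.
    apply/eqP; rewrite eq_le gf andbT; have [l' ->] := fg y.
    by rewrite !gE lerD2l lerN2 ler_wpM2l// ler_int.
  have [hall|] := pselect (forall l', l' != l -> m1%:Z < (val y).1 0 l').
    exists m1; split => //; apply: le_trans (itf l m1 y).
    rewrite fl; apply: hn1 => //; by rewrite mem_enum.
  move=> /existsNP[l' /not_implyP[l'l /negP]]; rewrite -leNgt => l'm1.
  have lm1 : (val y).1 0 l <= m1%:Z by exact: le_trans l'm1.
  (* This coordinate exceeds [m2], hence [m1], so [i] differs from [l] and [l'] and the three
     indices are exhausted. *)
  have [i im2] : exists i, m2%:Z < (val y).1 0 i.
    apply/not_existsP => h; move: c0y; apply/negP; rewrite -leNgt.
    rewrite le_max; apply/orP; left; apply: (le_trans (fw y)).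
    apply: (le_trans (ler_norm _)); apply: lin_le_norm1 => i.
    rewrite ger0_norm ?ler0z// -[m2%:R]/(m2%:Z%:~R) ler_int leNgt.
    by apply/negP; exact: h.
  have m1m2 : m1%:Z <= m2%:Z by rewrite lez_nat leq_maxl.
  have il : i != l by apply/eqP => E; move: im2; rewrite E ltNge (le_trans lm1).
  have il' : l' != i by apply/eqP => E; move: im2; rewrite -E ltNge (le_trans l'm1).
  have [|l0 [l0i hl0]] := hn2 m2 i (leq_maxr _ _); first by rewrite mem_enum.
  have l0m1 : (val y).1 0 l0 <= m1%:Z.
    case: (@ord3P i l l' il _ il' l0) => [|E|->|->]//; first by rewrite eq_sym.
    by rewrite E eqxx in l0i.
  exists m2; split => //; apply: le_trans (itf l0 m2 y).
  apply: le_trans (hl0 y im2); rewrite gE.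
  have : kap * ((val y).1 0 l0)%:~R <= kap * m1%:R.
    by rewrite ler_wpM2l// -[m1%:R]/(m1%:Z%:~R) ler_int.
  by have := fw y; lra.
- by rewrite le_max lexx orbT.
- apply: lt_le_trans (gf k2 y0); rewrite gE hy0 mxE /= mulr0 subr0.
  rewrite /lin (@big_ord3 _ k1 k2 k3)// hy0 !mxE /= !mulr0 !addr0.
  rewrite -[T%:~R]/(T%:R : R) mulrC; move: hT; rewrite ler_pdivrMr//; lra.
- by apply: (lt_le_trans q0); exact: (le_esc MK).
Qed.

End Spiral.

(** * The cycle of the three faces *)

(* A solution of the three inequalities exists exactly because the product of
   the slopes is on the right side of 1. *)
Lemma cycle_weights (R : realFieldType) (s1 s2 s3 : R) :
  0 < s1 -> 0 < s2 -> 0 < s3 ->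
  exists wi wj, [/\ 0 < wi, 0 < wj,
    s1 * s2 * s3 < 1 -> [/\ s1 * wj < wi, s2 < wj & wi * s3 < 1] &
    1 < s1 * s2 * s3 -> [/\ wi < s1 * wj, wj < s2 & 1 < wi * s3]].
Proof.
move=> s10 s20 s30.
have s120 : 0 < s1 * s2 by exact: mulr_gt0.
have v30 : 0 < s3^-1 by rewrite invr_gt0.
(* [m] is the midpoint of [s1 * s2] and [s3^-1], [wi] that of [m] and [s3^-1], and [wj] is [m / s1].
   So [s1 * s2], [s1 * wj], [wi], [s3^-1] are in monotone order, in the direction set by the
   product. *)
pose m := (s1 * s2 + s3^-1) / 2.
have m0 : 0 < m by rewrite divr_gt0// addr_gt0.
have wi3 : (m + s3^-1) / 2 * s3 = (s1 * s2 * s3 + 3) / 4.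
  by rewrite /m; field; rewrite gt_eqF.
have s1m : s1 * (m / s1) = m by rewrite mulrC divfK// gt_eqF.
have e : s1 * s2 * s3 = s1 * s2 / s3^-1 by rewrite invrK.
exists ((m + s3^-1) / 2), (m / s1); split.
- by rewrite divr_gt0// addr_gt0.
- by rewrite divr_gt0.
- rewrite wi3 s1m => r1; move: (r1); rewrite e ltr_pdivrMr// mul1r => h.
  by split; [rewrite /m; lra|rewrite ltr_pdivlMr// /m mulrC; lra|lra].
- rewrite wi3 s1m => r1; move: (r1); rewrite e ltr_pdivlMr// mul1r => h.
  by split; [rewrite /m; lra|rewrite ltr_pdivrMr// /m [s2 * s1]mulrC; lra|lra].
Qed.

Section Cycle.
Context (R : realType) (s : {set 'I_3} -> nat) (hs : forall A, (0 < s A)%N).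
Context (p : {set 'I_3} -> {set 'I_3} -> 'rV[int]_3 -> nat -> nat -> R).
Context (p_ge0 : forall A (y v : expanded_state s A), 0 <= expanded_kernel p y v).
Context (p_sum : forall A (y : expanded_state s A),
  \sum_(v <- exp_nbrs y) expanded_kernel p y v = 1).
Local Notation K := (expK p_ge0 p_sum).
Local Notation sinks := (sinks p_ge0 p_sum).
Context (E : forall A : {set 'I_3}, process R (expanded_state s A)).
Context (hE : forall A : {set 'I_3}, A != finset.set0 ->
  markov_chain (expanded_kernel p (A:=A)) (E A)).
Context (hind : forall A : {set 'I_3}, A != finset.set0 ->
  semi_irreducible_stable (induced_process (E A)) \/ transient_chain (induced_process (E A))).
Context (a : {set 'I_3} -> 'rV[R]_3).
Context (ha : forall A : {set 'I_3}, A != finset.set0 ->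
  semi_irreducible_stable (induced_process (E A)) -> mean_drift (E A) (a A)).
Context (haD : forall l, a [set: 'I_3]%SET 0 l < 0).
Local Notation aD := (a [set: 'I_3]%SET 0).
Local Notation aF l := (a [set~ l]%SET 0).

Lemma sinks_interior w : \sum_l w l * aD l < 0 -> sinks w [set: 'I_3]%SET.
Proof.
move=> wD.
have D0 : [set: 'I_3]%SET != finset.set0 by apply/finset.set0Pn; exists k1; rewrite inE.
have [sis|tr] := hind D0.
  by apply: (sinks_stable (hE D0) (ha D0 sis) wD) => l; rewrite inE.
exfalso; have [y _] := @expanded_at 3 s hs [set: 'I_3]%SET 0 (fun l _ => ltac:(by rewrite mxE)).
(* If the finite chain were transient, even the zero functional would sink. *)
apply: (@transientF _ _ _ _ p_ge0 p_sum (fun=> 0) _ _ 0 y (hE D0) tr) => [l|m].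
  by rewrite inE.
rewrite (@eq_iter_step _ _ (K _) m _ (fun=> 0)) ?iter_step_cst// => v.
by rewrite /= /lin big1// => l _; rewrite mul0r.
Qed.

Lemma setC1_neq0 (l : 'I_3) : [set~ l]%SET != finset.set0.
Proof.
apply/finset.set0Pn; have [->|] := eqVneq l k1; first by exists k2; rewrite !inE.
by move=> lk; exists k1; rewrite !inE eq_sym.
Qed.

Lemma setU1C1 (l : 'I_3) : (l |: [set~ l] = [set: 'I_3])%SET.
Proof. by apply/setP => l'; rewrite !inE orbN. Qed.

Lemma sinks_unitw l : sinks (unitw R l) [set: 'I_3]%SET.
Proof. by apply: sinks_interior; rewrite (sum_unitw l (fun l => aD l)) haD. Qed.

(** The coordinate [l] sinks in the interior, so a transient face chain would make its mean tend to
    [-oo], although it is nonnegative. *)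
Lemma face_stable l : semi_irreducible_stable (induced_process (E [set~ l]%SET)).
Proof.
have [//|tr] := hind (setC1_neq0 l).
have [y _] := @expanded_at 3 s hs [set~ l]%SET 0 (fun l _ => ltac:(by rewrite mxE)).
have [] := @transientF _ _ _ _ p_ge0 p_sum (unitw R l) _ _ 0 y (hE (setC1_neq0 l)) tr.
  by move=> l'; rewrite !inE negbK => /eqP ->; rewrite setU1C1; exact: sinks_unitw.
by move=> m; apply: iter_coord_ge0; rewrite !inE eqxx.
Qed.

Lemma face_drift_orth l : aF l l = 0.
Proof.
apply: (mean_drift_orth hs (p_ge0 := p_ge0) (p_sum := p_sum) (hE (setC1_neq0 l))).
- exact: ha (setC1_neq0 l) (face_stable l).
- by rewrite !inE eqxx.
- by rewrite setU1C1; exact: sinks_unitw.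
Qed.

Lemma sinks_face w l : \sum_l' w l' * aD l' < 0 -> \sum_l' w l' * aF l l' < 0 ->
  sinks w [set~ l]%SET.
Proof.
move=> wD wF.
apply: (sinks_stable (hE (setC1_neq0 l)) (ha (setC1_neq0 l) (face_stable l)) wF).
by move=> l'; rewrite !inE negbK => /eqP ->; rewrite setU1C1; exact: sinks_interior.
Qed.

Lemma set1_neq0 (l : 'I_3) : [set l]%SET != finset.set0.
Proof. by apply/finset.set0Pn; exists l; rewrite inE. Qed.

Lemma setU1_axis (i j k : 'I_3) : i != j -> j != k -> k != i ->
  (j |: [set i] = [set~ k])%SET /\ (k |: [set i] = [set~ j])%SET.
Proof.
move=> ij jk ki.
by split; apply/setP => l; rewrite !inE; case: (ord3P ij jk ki l) => ->;
  rewrite ?eqxx ?orbT ?(negbTE ij) ?(negbTE jk) ?(negbTE ki) 1?eq_sym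
    ?(negbTE ij) ?(negbTE jk) ?(negbTE ki)// eq_sym ?(negbTE ij) ?(negbTE jk) ?(negbTE ki).
Qed.

Lemma axis_faces w (i j k : 'I_3) : i != j -> j != k -> k != i ->
  sinks w [set~ k]%SET -> sinks w [set~ j]%SET ->
  forall l, l \notin [set i]%SET -> sinks w (l |: [set i])%SET.
Proof.
move=> ij jk ki sk sj l; rewrite inE => li.
have [ej ek] := setU1_axis ij jk ki.
by move: li; case: (ord3P ij jk ki l) => ->; rewrite ?eqxx ?ej ?ek.
Qed.

(** The form [- x_j + kap * x_k] sinks on both faces adjacent to the axis [i], vanishes along the
    axis and is unbounded below, so the induced chain cannot be stable. *)
Lemma axis_transient (i j k : 'I_3) : i != j -> j != k -> k != i ->
  0 < aF k j -> aF j k < 0 -> transient_chain (induced_process (E [set i]%SET)).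
Proof.
move=> ij jk ki akj ajk; have [sis|//] := hind (set1_neq0 i).
(* This value makes the interior drift [- aD j + kap * aD k] equal to [aD k]. *)
exfalso; pose kap := aD j / aD k + 1.
have kap0 : 0 < kap by rewrite ltr_wpDl// ltW// nmulr_lgt0// invr_lt0.
have kapD : kap * aD k = aD j + aD k.
  by rewrite mulrDl mul1r divfK// lt_eqF.
pose w l : R := if l == i then 0 else if l == j then -1 else kap.
have wi : w i = 0 by rewrite /w eqxx.
have wj : w j = -1 by rewrite /w eqxx eq_sym (negbTE ij).
have wk : w k = kap by rewrite /w (negbTE ki) eq_sym (negbTE jk).
have wE F : \sum_l w l * F l = - F j + kap * F k.
  by rewrite (big_ord3 _ ij jk ki) wi wj wk mul0r add0r mulN1r.
have wD : \sum_l w l * aD l < 0.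
  by rewrite (wE (fun l => aD l)) kapD; have := haD k; lra.
apply: (@sinks_not_stable _ _ _ _ p_ge0 p_sum w _ _ (hE (set1_neq0 i)) _ _ _ sis).
- by move=> l; rewrite inE => /eqP ->.
- apply: (axis_faces ij jk ki); apply: sinks_face => //.
    by rewrite (wE (fun l => aF k l)) face_drift_orth mulr0 addr0 oppr_lt0.
  by rewrite (wE (fun l => aF j l)) face_drift_orth oppr0 add0r pmulr_rlt0.
- move=> B; have [T hT] := nat_above (1 - B).
  have [y hy] := @expanded_at 3 s hs [set i]%SET
    (\row_l (if l == j then T%:Z else 0)) (fun l _ => ltac:(by rewrite mxE; case: eqP)).
  exists y; rewrite /lin (wE (fun l => ((val y).1 0 l)%:~R)) hy !mxE eqxx.
  rewrite eq_sym (negbTE jk) mulr0 addr0 -[T%:~R]/(T%:R : R); lra.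
Qed.

Lemma sinks_axis w (i j k : 'I_3) : i != j -> j != k -> k != i ->
  0 < aF k j -> aF j k < 0 ->
  sinks w [set~ k]%SET -> sinks w [set~ j]%SET -> sinks w [set i]%SET.
Proof.
move=> ij jk ki akj ajk sk sj.
apply: (sinks_transient (hE (set1_neq0 i)) (axis_transient ij jk ki akj ajk)).
exact: (axis_faces ij jk ki).
Qed.

(** Stated for any labelling [i], [j], [k] of the three indices, so that it covers both orientations
    of the cycle. *)
Lemma spiral (L : process R (mmrrw_state s)) (S0 : set (mmrrw_state s)) (i j k : 'I_3) :
  markov_chain (mmrrw_kernel p) L -> semi_irreducible L S0 ->
  i != j -> j != k -> k != i ->
  aF k i < 0 -> 0 < aF k j -> aF i j < 0 -> 0 < aF i k -> aF j k < 0 -> 0 < aF j i ->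
  let r := `|aF k j / aF k i| * `|aF i k / aF i j| * `|aF j i / aF j k| in
  (r < 1 -> stable L S0) /\ (1 < r -> unstable L S0).
Proof.
move=> hL hS ij jk ki aki akj aij aik ajk aji r.
have slope (x y : R) : 0 < x -> y < 0 -> 0 < x / - y by move=> ? ?; rewrite divr_gt0 ?oppr_gt0.
have [wi [wj [wi0 wj0 wlt wgt]]] :=
  cycle_weights (slope _ _ akj aki) (slope _ _ aik aij) (slope _ _ aji ajk).
have normE (x y : R) : 0 < x -> y < 0 -> `|x / y| = x / - y.
  by move=> x0 y0; rewrite ler0_norm ?invrN ?mulrN// ltW// pmulr_rlt0// invr_lt0.
have -> : r = aF k j / - aF k i * (aF i k / - aF i j) * (aF j i / - aF j k).
  by rewrite /r !normE.
have slopeK (x y : R) : y < 0 -> x / - y * - y = x by move=> y0; rewrite divfK// oppr_eq0 lt_eqF.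
pose w l : R := if l == i then wi else if l == j then wj else 1.
have wI : w i = wi by rewrite /w eqxx.
have wJ : w j = wj by rewrite /w eqxx eq_sym (negbTE ij).
have wK : w k = 1 by rewrite /w (negbTE ki) eq_sym (negbTE jk).
have w0 l : 0 < w l by rewrite /w; do !case: ifP.
have wE F : \sum_l w l * F l = wi * F i + wj * F j + F k.
  by rewrite (big_ord3 _ ij jk ki) wI wJ wK mul1r.
have wD : \sum_l w l * aD l < 0.
  rewrite (wE (fun l => aD l)).
  have := haD k; have : wi * aD i < 0 by rewrite pmulr_rlt0.
  have : wj * aD j < 0 by rewrite pmulr_rlt0.
  lra.
set s1 := aF k j / - aF k i in wlt wgt *.
set s2 := aF i k / - aF i j in wlt wgt *.
set s3 := aF j i / - aF j k in wlt wgt *.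
(* Because the drifts are tangent to their faces, each drift of [w] is a positive factor times one
   of the three differences whose signs [cycle_weights] controls. *)
have Fk : \sum_l w l * aF k l = - aF k i * (s1 * wj - wi).
  rewrite (wE (fun l => aF k l)) face_drift_orth addr0.
  by rewrite -[in LHS](slopeK (aF k j) _ aki) -/s1; ring.
have Fi : \sum_l w l * aF i l = - aF i j * (s2 - wj).
  rewrite (wE (fun l => aF i l)) face_drift_orth mulr0 add0r.
  by rewrite -[in LHS](slopeK (aF i k) _ aij) -/s2; ring.
have Fj : \sum_l w l * aF j l = - aF j k * (wi * s3 - 1).
  rewrite (wE (fun l => aF j l)) face_drift_orth mulr0 addr0.
  by rewrite -[in LHS](slopeK (aF j i) _ ajk) -/s3; ring.
split.
  move=> /wlt[h1 h2 h3].
  have sk : sinks w [set~ k]%SET.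
    by apply: sinks_face => //; rewrite Fk pmulr_rlt0 ?oppr_gt0// subr_lt0.
  have si : sinks w [set~ i]%SET.
    by apply: sinks_face => //; rewrite Fi pmulr_rlt0 ?oppr_gt0// subr_lt0.
  have sj : sinks w [set~ j]%SET.
    by apply: sinks_face => //; rewrite Fj pmulr_rlt0 ?oppr_gt0// subr_lt0.
  apply: (stable_of_sinks (p_ge0 := p_ge0) (p_sum := p_sum) hL hS (w := w)) => l.
    exact: ltW.
  case: (ord3P ij jk ki l) => ->.
  - exact: (sinks_axis ij jk ki).
  - exact: (sinks_axis jk ki ij).
  - exact: (sinks_axis ki ij jk).
move=> /wgt[h1 h2 h3].
(* The interior drift of [v l] is negative exactly when the constant [kap] exceeds [q l]; the sum
   plus 1 exceeds all three. *)
pose q l := (\sum_l' w l' * aD l') / aD l.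
have q0 l : 0 < q l by rewrite /q nmulr_lgt0// invr_lt0.
pose kap := \sum_l q l + 1.
have kap0 : 0 <= kap by rewrite addr_ge0// sumr_ge0// => l _; exact: ltW.
have qkap l : q l < kap.
  by rewrite /kap (bigD1 l)//= -addrA ltrDl ltr_wpDl// sumr_ge0// => l' _; exact: ltW.
pose v l l' : R := - (w l' - kap * (l' == l)%:R).
have vE l F : \sum_l' v l l' * F l' = - (\sum_l' w l' * F l') + kap * F l.
  rewrite -(sum_unitw l F) mulr_sumr -sumrN -big_split; apply: eq_bigr => l' _ /=.
  by rewrite /v /unitw; ring.
have vD l : \sum_l' v l l' * aD l' < 0.
  rewrite (vE l (fun l' => aD l')) addrC subr_lt0.
  by rewrite -(ltr_ndivrMr _ _ (haD l)) qkap.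
have Fk0 : 0 < \sum_l w l * aF k l by rewrite Fk pmulr_rgt0 ?oppr_gt0// subr_gt0.
have Fi0 : 0 < \sum_l w l * aF i l by rewrite Fi pmulr_rgt0 ?oppr_gt0// subr_gt0.
have Fj0 : 0 < \sum_l w l * aF j l by rewrite Fj pmulr_rgt0 ?oppr_gt0// subr_gt0.
have sv l l' : 0 < \sum_l0 w l0 * aF l' l0 -> aF l' l <= 0 -> sinks (v l) [set~ l']%SET.
  move=> F0 al; apply: sinks_face => //; rewrite (vE l (fun l0 => aF l' l0)).
  have : kap * aF l' l <= 0 by rewrite mulr_ge0_le0.
  lra.
have sd l : 0 < \sum_l0 w l0 * aF l l0 -> sinks (v l) [set~ l]%SET.
  by move=> F0; apply: sv => //; rewrite face_drift_orth.
apply: (unstable_of_sinks hs (p_ge0 := p_ge0) (p_sum := p_sum) hL _ w0 kap0).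
- by case: hS.
- by move=> l; case: (ord3P ij jk ki l) => ->; exact: sd.
(* Around each axis the chosen form subtracts the coordinate that decreases along one adjacent face
   and has zero drift on the other, so the term in [kap] does no harm. *)
- move=> l; case: (ord3P ij jk ki l) => ->.
  + exists k; split => //; apply: (sinks_axis ij jk ki) => //; first exact: sd.
    by apply: sv => //; exact: ltW.
  + exists i; split => //; apply: (sinks_axis jk ki ij) => //; first exact: sd.
    by apply: sv => //; exact: ltW.
  + exists j; split => //; apply: (sinks_axis ki ij jk) => //; first exact: sd.
    by apply: sv => //; exact: ltW.
Qed.

End Cycle.

(** For every index some process has the expanded kernel, [L] for the empty set and [E A] otherwise;
    hence the kernels are nonnegative with row sums 1. *)
Lemma spiral_markov (R : realType) (s : {set 'I_3} -> nat) (hs : forall A, (0 < s A)%N)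
  (p : {set 'I_3} -> {set 'I_3} -> 'rV[int]_3 -> nat -> nat -> R)
  (L : process R (mmrrw_state s)) (hL : markov_chain (mmrrw_kernel p) L)
  (E : forall A : {set 'I_3}, process R (expanded_state s A))
  (hE : forall A : {set 'I_3}, A != finset.set0 ->
     markov_chain (expanded_kernel p (A:=A)) (E A))
  (S0 : set (mmrrw_state s)) (hS0 : semi_irreducible L S0)
  (hind : forall A : {set 'I_3}, A != finset.set0 ->
     semi_irreducible_stable (induced_process (E A)) \/
     transient_chain (induced_process (E A)))
  (a : {set 'I_3} -> 'rV[R]_3)
  (ha : forall A : {set 'I_3}, A != finset.set0 ->
     semi_irreducible_stable (induced_process (E A)) -> mean_drift (E A) (a A))
  (haD : forall l, a [set: 'I_3]%SET 0 l < 0) (i j k : 'I_3) :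
  i != j -> j != k -> k != i ->
  let aF l := a [set~ l]%SET 0 in
  aF k i < 0 -> 0 < aF k j -> aF i j < 0 -> 0 < aF i k -> aF j k < 0 -> 0 < aF j i ->
  let r := `|aF k j / aF k i| * `|aF i k / aF i j| * `|aF j i / aF j k| in
  (r < 1 -> stable L S0) /\ (1 < r -> unstable L S0).
Proof.
have hK A : exists M, markov_chain (@expanded_kernel R 3 s p A) M.
  by have [->|A0] := eqVneq A finset.set0; [exists L|exists (E A); exact: hE].
have p_ge0 A (y v : expanded_state s A) : 0 <= expanded_kernel p y v.
  by have [M MM] := hK A; exact: (markov_ge0 MM).
have p_sum A (y : expanded_state s A) :
    \sum_(v <- exp_nbrs y) expanded_kernel p y v = 1.
  have [M MM] := hK A; apply: (markov_sum1 MM); first exact: exp_nbrs_uniq.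
  by move=> v; exact: exp_out.
move=> ij jk ki aF.
exact: (spiral hs p_ge0 p_sum hE hind ha haD hL hS0 ij jk ki).
Qed.

End Spiral.

Theorem theorem3p5 (R : realType)
  (s : {set 'I_3} -> nat) (hs : forall A, (0 < s A)%N)
  (p : {set 'I_3} -> {set 'I_3} -> 'rV[int]_3 -> nat -> nat -> R)
  (L : process R (mmrrw_state s))
  (hL : markov_chain (mmrrw_kernel p) L)
  (E : forall A : {set 'I_3}, process R (expanded_state s A))
  (hE : forall A : {set 'I_3}, A != finset.set0 -> markov_chain (expanded_kernel p (A:=A)) (E A))
  (S0 : set (mmrrw_state s))
  (hS0 : semi_irreducible L S0)
  (hind : forall A : {set 'I_3}, A != finset.set0 ->
     semi_irreducible_stable (induced_process (E A)) \/ transient_chain (induced_process (E A)))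
  (hzero : exists y : mmrrw_state s, S0 y /\ (val y).1 = 0)
  (a : {set 'I_3} -> 'rV[R]_3)
  (ha : forall A : {set 'I_3}, A != finset.set0 ->
     semi_irreducible_stable (induced_process (E A)) -> mean_drift (E A) (a A))
  (haD : forall l, a [set: 'I_3]%SET 0 l < 0) :
  let a12 := a [set k1; k2]%SET 0 in
  let a23 := a [set k2; k3]%SET 0 in
  let a31 := a [set k3; k1]%SET 0 in
  let r := `|a12 k2 / a12 k1| * `|a23 k3 / a23 k2| * `|a31 k1 / a31 k3| in
  ([/\ a12 k1 < 0 /\ 0 < a12 k2, a23 k2 < 0 /\ 0 < a23 k3
     & a31 k3 < 0 /\ 0 < a31 k1] ->
   (r < 1 -> stable L S0) /\ (1 < r -> unstable L S0)) /\
  ([/\ 0 < a12 k1 /\ a12 k2 < 0, 0 < a23 k2 /\ a23 k3 < 0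
     & 0 < a31 k3 /\ a31 k1 < 0] ->
   (1 < r -> stable L S0) /\ (r < 1 -> unstable L S0)).

Proof.
have F12 : [set k1; k2]%SET = [set~ k3]%SET.
  by apply/setP => l; rewrite !inE; case: (@Spiral.ord3P k1 k2 k3 isT isT isT l) => ->.
have F23 : [set k2; k3]%SET = [set~ k1]%SET.
  by apply/setP => l; rewrite !inE; case: (@Spiral.ord3P k1 k2 k3 isT isT isT l) => ->.
have F31 : [set k3; k1]%SET = [set~ k2]%SET.
  by apply/setP => l; rewrite !inE; case: (@Spiral.ord3P k1 k2 k3 isT isT isT l) => ->.
have core := @Spiral.spiral_markov R s hs p L hL E hE S0 hS0 hind a ha haD.
rewrite /= F12 F23 F31; split=> [[[h1 h2] [h3 h4] [h5 h6]]|[[h1 h2] [h3 h4] [h5 h6]]].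
  exact: (core k1 k2 k3 isT isT isT).
(* Exchanging [k1] and [k2] reverses the cycle, brings the signs of the second case to those of the
   first, and replaces [r] by its inverse. *)
have := core k2 k1 k3 isT isT isT h2 h1 h6 h5 h4 h3.
set r := `|_| * `|_| * `|_|; set r' := `|_| * `|_| * `|_|.
have rr' : r * r' = 1.
  rewrite /r /r' -!normrM -[RHS](normr1 R); congr (`|_|); field.
  by rewrite (lt_eqF h2) (lt_eqF h4) (lt_eqF h6) !gt_eqF.
have r0 : 0 < r.
  rewrite lt0r !mulr_ge0// andbT; apply/eqP => r00.
  by move/eqP: rr'; rewrite r00 mul0r eq_sym oner_eq0.
have r'E : r' = r^-1.
  by rewrite -[LHS](mulKf (lt0r_neq0 r0)) rr' mulr1.
rewrite r'E => -[st un]; split=> hr.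
  by apply: st; rewrite -invf_gt1.
by apply: un; rewrite -invf_lt1.
Qed.
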